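(* Let $\Gamma$ be a metric graph, $v\in\Gamma$ and $A$ a nonempty subset of $\Gamma$. Then $v\in\mathcal L(A)$ if and only if every special open set $U$ containing $v$ satisfies $A\cap U\neq\emptyset$. Furthermore, $\mathcal L(A)=\bigcap_{U\in\mathcal S_\Gamma,\,U\cap A=\emptyset}(\Gamma\setminus U)$. In addition, $A$ is a rank-determining set of $\Gamma$ if and only if every nonempty special open set on $\Gamma$ intersects $A$.
   Context: A metric graph $\Gamma$ is the geometric realization of a finite connected loopless multigraph with each edge identified with a closed interval of positive length. Divisors are elements of the free abelian group on the points of $\Gamma$; rational functions are continuous piecewise linear functions with integral slopes, $(f)=\sum_v\mathrm{ord}_vf\,(v)$ with $\mathrm{ord}_vf$ the sum of outgoing slopes at $v$; $D\sim D'$ iff $D-D'=(f)$; $|D|$ is the set of effective divisors linearly equivalent to $D$. $\mathrm{supp}\,D=\{v:D(v)\ne0\}$ and $\mathrm{supp}|D|=\bigcup_{D'\in|D|}\mathrm{supp}\,D'$. For nonempty $A\subseteq\Gamma$, $\mathcal L(A)$ is the set of $v\in\Gamma$ such that for every divisor $D$, $A\subseteq\mathrm{supp}|D|$ implies $v\in\mathrm{supp}|D|$. For a closed $X\subseteq\Gamma$ with finitely many components and $v\in\partial X$, $\mathrm{outdeg}_X(v)$ is the maximum number of internally disjoint segments of $\Gamma\setminus X$ with an open end at $v$. A special open set is a connected open $U\subseteq\Gamma$ such that $U=\emptyset$, or $U=\Gamma$, or every connected component $X$ of $\Gamma\setminus U$ contains a boundary point $v$ with $\mathrm{outdeg}_X(v)\ge2$;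 $\mathcal S_\Gamma$ is the set of special open sets. Rank: $r(D)=-1$ if $|D|=\emptyset$, otherwise $r(D)\ge s\ge0$ iff $|D-E|\ne\emptyset$ for all effective $E$ of degree $s$; $r_A(D)$ is the same with $E$ supported on $A$; $A$ is rank-determining if $r(D)=r_A(D)$ for all $D$. *)

(* Defs.v *)
From HB Require Import structures.
From mathcomp Require Import all_boot all_order all_algebra.
From mathcomp Require Import all_classical all_reals all_analysis.
From mathcomp.multinomials Require Import freeg.

Set Implicit Arguments.
Unset Strict Implicit.
Unset Printing Implicit Defensive.

Import Order.TTheory GRing.Theory Num.Theory.
Import numFieldNormedType.Exports.

Local Open Scope classical_set_scope.
Local Open Scope ring_scope.

(* A finite connected loopless multigraph whose edges have positive lengths.  *)
(* The orientation of an edge e from [src e] to [tgt e] is arbitrary: it only *)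
(* fixes the identification of e with the interval [0, len e].                *)
Record metric_graph (R : realType) := MetricGraph {
  vertex : finType;
  edge : finType;
  src : edge -> vertex;
  tgt : edge -> vertex;
  len : edge -> R;
  len_gt0 : forall e, 0 < len e;
  src_neq_tgt : forall e, src e != tgt e;
  vertex_gt0 : (0 < #|vertex|)%N;
  graph_connected : forall u w : vertex,
    connect (fun x y => [exists e, ((src e == x) && (tgt e == y))
                                || ((src e == y) && (tgt e == x))]) u w
}.
Arguments src {R m} _.
Arguments tgt {R m} _.
Arguments len {R m} _.

(* The geometric realization, as the disjoint union of the vertices and of    *)
(* the open edges; [inr (e, t)] is the point at distance t from [src e] on e. *)
Definition mg_point (R : realType) (G : metric_graph R) : Type :=
  (vertex G + {x : edge G * R | 0 < x.2 < len x.1})%type.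

HB.instance Definition _ (R : realType) (G : metric_graph R) :=
  Choice.on (mg_point G).

(* The identification of [0, len e] with the closed edge e, extended to R by  *)
(* the constants [src e] and [tgt e].                                         *)
Definition edge_pt (R : realType) (G : metric_graph R) (e : edge G) (t : R) :
    mg_point G :=
  match insub (e, t) with
  | Some x => inr x
  | None => inl (if t <= 0 then src e else tgt e)
  end.

(* The quotient topology of the disjoint union of the closed edges. As        *)
(* [edge_pt e] is constant on each side of [0, len e], a preimage under it is *)
(* open in R if and only if its trace on [0, len e] is relatively open.       *)
(* Without edges, the graph is reduced to a point.                            *)
Definition point_open (R : realType) (G : metric_graph R) :
    set_system (mg_point G) :=
  [set U | forall e : edge G, open (edge_pt e @^-1` U)].

Section PointTopology.
Variables (R : realType) (G : metric_graph R).

Lemma point_openT : @point_open R G setT.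
Proof. by move=> e; rewrite preimage_setT; exact: openT. Qed.

Lemma point_openI : setI_closed (@point_open R G).
Proof. by move=> U W hU hW e; rewrite preimage_setI; exact: openI. Qed.

Lemma point_open_bigU (I : Type) (f : I -> set (mg_point G)) :
  (forall i, point_open (f i)) -> point_open (\bigcup_i f i).
Proof.
by move=> hf e; rewrite preimage_bigcup; apply: bigcup_open => i _; exact: hf.
Qed.

HB.instance Definition _ :=
  isOpenTopological.Build (mg_point G) point_openT point_openI point_open_bigU.

Lemma point_openE : (open : set_system (mg_point G)) = @point_open R G.
Proof. by []. Qed.

End PointTopology.

Section MetricGraph.
Variables (R : realType) (G : metric_graph R).
Implicit Types (f : mg_point G -> R) (p v : mg_point G).
Implicit Types (A X U S : set (mg_point G)).

Definition divisor : Type := {freeg mg_point G}.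
Implicit Types D E : divisor.

(* [itv_partition a b s] says that a :: s is increasing and ends at b. *)
Definition piecewise_linear_int (a b : R) (g : R -> R) :=
  exists s : seq R, itv_partition a b s /\
    forall i, (i < size s)%N -> exists m : int,
      forall t, t \in `[nth b (a :: s) i, nth b s i] ->
        g t = g (nth b (a :: s) i) + m%:~R * (t - nth b (a :: s) i).

Definition rational_function f :=
  continuous f /\
  forall e : edge G, piecewise_linear_int 0 (len e) (f \o edge_pt e).

(* An outgoing direction at p is a pair (e, b): one moves along the edge e,   *)
(* away from [src e] if b is true and towards [src e] if b is false.          *)
Definition directions p : {set edge G * bool} :=
  match p with
  | inl v => [set d | (if d.2 then src d.1 else tgt d.1) == v]
  | inr x => [set d | d.1 == (val x).1]
  end.

(* The point at distance h from p in the direction d, for small h >= 0. *)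
Definition move p (d : edge G * bool) (h : R) : mg_point G :=
  let start := match p with
               | inl _ => if d.2 then 0 else len d.1
               | inr x => (val x).2
               end in
  edge_pt d.1 (if d.2 then start + h else start - h).

Definition slope f p (d : edge G * bool) : int :=
  xget 0 [set m : int | \forall h \near 0^'+, f (move p d h) = f p + m%:~R * h].

Definition ord f p : int := \sum_(d in directions p) slope f p d.

(* A finitely supported sum: [ord f] vanishes at all but finitely many points *)
(* if f is a rational function.                                               *)
Definition principal f : divisor :=
  \sum_(p \in [set: mg_point G]) << ord f p *g p >>.

Definition lin_equiv D E :=
  exists f, rational_function f /\ D - E = principal f.

Definition effective D := forall p, 0 <= coeff p D.

Definition linsys D : set divisor := [set E | effective E /\ lin_equiv E D].

Definition supp D : set (mg_point G) := [set p | coeff p D != 0].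

Definition supp_linsys D : set (mg_point G) :=
  \bigcup_(E in linsys D) supp E.

Definition calL A : set (mg_point G) :=
  [set v | forall D, A `<=` supp_linsys D -> supp_linsys D v].

(* For nonempty A and nonempty [linsys D], exactly one integer r has the      *)
(* property below; the default value -1 of xget is not used then.             *)
Definition rank_on A D : int :=
  if `[< linsys D = set0 >] then -1 else
  xget (-1) [set r : int | forall s : nat, s%:Z <= r <->
    forall E, effective E -> deg E = s%:Z -> supp E `<=` A ->
      linsys (D - E) !=set0].

Definition rank D : int := rank_on setT D.

Definition rank_determining A := forall D, rank D = rank_on A D.

Definition boundary X : set (mg_point G) := closure X `\` X°.

(* An open segment lying on an edge, with v as one of its two open ends. *)
Definition segment_at v S :=
  exists (e : edge G) (a b : R),
    [/\ 0 <= a, a < b, b <= len e, S = edge_pt e @` `]a, b[ &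
        v = edge_pt e a \/ v = edge_pt e b].

Definition has_out_segments X v (n : nat) :=
  exists S : 'I_n -> set (mg_point G),
    (forall i, segment_at v (S i) /\ S i `<=` ~` X) /\ trivIset setT S.

(* The maximum exists: n is at most the number of directions at v. *)
Definition outdeg X v : nat :=
  xget 0%N [set n | has_out_segments X v n /\
                    forall m, has_out_segments X v m -> (m <= n)%N].

Definition component_of X U := exists2 x, U x & X = connected_component U x.

Definition special_open U :=
  [/\ connected U, open U &
      [\/ U = set0, U = setT |
          forall X, component_of X (~` U) ->
            exists2 v, boundary X v & (2 <= outdeg X v)%N]].

End MetricGraph.

(* Main.v *)
Require Import Defs.
From mathcomp Require Import all_boot all_order all_algebra.
From mathcomp Require Import all_classical all_reals all_analysis.
From mathcomp Require Import ring lra zify.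
From mathcomp.multinomials Require Import freeg.

(* The main tool is that of a divisor reduced at a point w: an effective D    *)
(* such that D + (g) >= 0 implies g <= g(w). One exists in every nonempty     *)
(* linear system, namely D + (s), where s is the supremum of the f with       *)
(* D + (f) >= 0 and f(w) = 0; it is piecewise linear with integral slopes     *)
(* because the slopes of these f are bounded by deg D and the f are convex    *)
(* away from D.                                                               *)
(* If w is not in supp|D|, let E ~ D be reduced at w and W the component of w *)
(* in the complement of supp E. No point of W is in supp|D|, and W is         *)
(* special: otherwise a component X of its complement could send one chip in  *)
(* each direction leaving X, and -min(eps, dist(., X)) would contradict the   *)
(* reducedness of E. Hence v is in L(A) if every special set containing v     *)
(* meets A.                                                                   *)
(* Conversely, let U be special with U and A disjoint. Give each boundary     *)
(* point p of U as many chips as it has directions into U, but one less when  *)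
(* there are at least two of them ("forks"), and add a maximal finite set F   *)
(* of single chips inside the complement of U such that a fire entering the   *)
(* complement of U at the forks still burns everything. Then no chip can ever *)
(* be moved into U. By the first part, a point outside U and supp|D| would    *)
(* lie in a special W avoiding U and supp D; adding to F a chip of W close to *)
(* a fork of W contradicts the maximality of F. So A is in supp|D|, while U   *)
(* is disjoint from it.                                                       *)
(* Rank-determining sets are then handled by exchanging the points of a test  *)
(* divisor for points of A one at a time.                                     *)

Set Implicit Arguments.
Unset Strict Implicit.
Unset Printing Implicit Defensive.

Import Order.TTheory GRing.Theory Num.Theory.
Import numFieldNormedType.Exports.

Local Open Scope classical_set_scope.
Local Open Scope ring_scope.

(** Moves of chips are studied on the set where a function is maximal. If D + (g) is effective, a
    point where g is maximal pays one chip of D for every direction along which g drops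
    ([max_chips]). So the maximal set of g can be left only where D has enough chips on its
    boundary.

    For [special_calL], a divisor E reduced at w ([exists_reduced]) lets no move leave w, so every
    move is constant on the component W of w off supp E ([reduced_unmoved]). If a component X of the
    complement of W could pay for all its leaving directions, [bump_exists] would fire X and
    contradict reducedness. Some point of X is thus short of chips; it carries at least one, hence
    has two directions into W, and W is special ([special_avoiding]).

    For [calL_special], the divisor of [fork_divisor] is one chip short at each fork of U, and the
    other points that a move could start from are guarded by the chips of F. Maximality of F
    ([fireproof_max_meets]) excludes every special W that would separate a point of A from supp|D|.
    Finally [rank_determiningP] identifies rank-determining sets with those A for which every point
    is in L(A).

    Topology and piecewise linearity are handled by germs, that is by what holds at [move p d h] for
    all small h > 0. The dictionary consists of [point_nbhsP], [connected_locally_constant] and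
    [rational_functionP]. *)

Section RealLine.

(** * Right germs at 0 and continuous induction *)

Variable R : realType.

Lemma near0P (P : R -> Prop) :
  (\forall h \near 0^'+, P h) <->
  exists2 eps : R, 0 < eps & forall h, 0 < h -> h < eps -> P h.
Proof.
split=> [|[e e0 H]].
  move=> [e /= e0 H]; exists e => // h h0 he.
  by apply: H => //=; rewrite sub0r normrN gtr0_norm.
near=> h; apply: H; near: h; first exact: nbhs_right_gt.
exact: nbhs_right_lt.
Unshelve. all: by end_near. Qed.

Lemma near0_lt (e : R) : 0 < e -> \forall h \near 0^'+, h < e.
Proof. exact: nbhs_right_lt. Qed.

Lemma near0_gt : \forall h \near (0 : R)^'+, 0 < h.
Proof. exact: nbhs_right_gt. Qed.

(** Stands in for the compactness of an interval. The [t] such that [P] holds on all of [a, t] have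
    a supremum; the limit clause puts it in the set, and the step clause passes beyond it unless it
    is [b]. *)
Lemma real_induction (P : R -> Prop) (a b : R) : a <= b ->
  P a ->
  (forall t, a <= t -> t < b -> P t -> \forall h \near 0^'+, P (t + h)) ->
  (forall t, a < t -> t <= b -> (forall s, a <= s -> s < t -> P s) -> P t) ->
  forall t, a <= t -> t <= b -> P t.
Proof.
move=> ab Pa step lim.
pose Q t := forall s, a <= s -> s <= t -> P s.
pose T := [set t | a <= t <= b /\ Q t].
have Ta : T a.
  split; first by rewrite lexx ab.
  by move=> s as_ sa; have -> : s = a by apply/eqP; rewrite eq_le as_ sa.
have hT : has_sup T.
  by split; [exists a | exists b => t [/andP[]]].
set c := sup T.
have ac : a <= c by apply: ub_le_sup => //; case: hT.
have cb : c <= b.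
  by apply: ge_sup; [exists a | move=> t [/andP[]]].
have Qlt s : a <= s -> s < c -> P s.
  move=> as_ sc; have [t [tab Qt] st] := sup_adherent (eps := c - s) (ltac:(by rewrite subr_gt0)) hT.
  apply: Qt => //; move: st; rewrite -/c; lra.
have Pc : P c.
  move: ac; rewrite le_eqVlt => /orP[/eqP <- //|ac].
  by apply: lim.
have Qc : Q c.
  move=> s as_; rewrite le_eqVlt => /orP[/eqP -> //|sc]; exact: Qlt.
suff -> : b = c by exact: Qc.
apply/eqP; rewrite eq_le cb andbT leNgt; apply/negP => cltb.
have /near0P [e e0 He] := step _ ac cltb Pc.
pose d := Num.min (e / 2) (b - c).
have d0 : 0 < d by rewrite lt_min; apply/andP; split; lra.
have de : d < e by rewrite gt_min; apply/orP; left; lra.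
have db : d <= b - c by rewrite ge_min lexx orbT.
have : T (c + d).
  split; first by apply/andP; split; lra.
  move=> s as_ sd; case: (leP s c) => [/Qc|cs]; first exact.
  have -> : s = c + (s - c) by ring.
  apply: He; lra.
move=> /(ub_le_sup (proj2 hT)); rewrite -/c; lra.
Qed.

End RealLine.

(** * Directions, moves and neighbourhoods in a metric graph *)

Section Points.
Variables (R : realType) (G : metric_graph R).
Local Notation pt := (mg_point G).
Implicit Types (e : edge G) (p q : pt) (d : edge G * bool) (S T : set pt).

Lemma edge_pt_in e (t : R) (h : 0 < t < len e) :
  edge_pt e t = inr (exist (fun x : edge G * R => 0 < x.2 < len x.1) (e, t) h) :> pt.
Proof.
rewrite /edge_pt; case: insubP => [u _ uE|]; last by rewrite h.
by congr inr; apply: val_inj.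
Qed.

Lemma edge_pt_le0 e (t : R) : t <= 0 -> edge_pt e t = inl (src e) :> pt.
Proof.
move=> t0; rewrite /edge_pt insubF ?t0 //=.
by apply/negbTE; rewrite negb_and -leNgt t0.
Qed.

Lemma edge_pt_ge e (t : R) : len e <= t -> edge_pt e t = inl (tgt e) :> pt.
Proof.
move=> t0; rewrite /edge_pt insubF /=; last first.
  by apply/negbTE; rewrite negb_and -!leNgt t0 orbT.
by rewrite leNgt (lt_le_trans (len_gt0 e) t0).
Qed.

Lemma edge_pt_eq e e' (t t' : R) : 0 < t -> t < len e ->
  edge_pt e t = edge_pt e' t' :> pt -> e = e' /\ t = t'.
Proof.
move=> t0 tl; rewrite (edge_pt_in (introT andP (conj t0 tl))) /=.
rewrite /edge_pt; case: insubP => [u _ uE|//].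
move=> /(congr1 (fun z => if z is inr y then Some (val y) else None)) /=.
by rewrite uE => -[-> ->].
Qed.

Lemma edge_pt_vertex e (t : R) (x : vertex G) :
  edge_pt e t = inl x -> t <= 0 \/ len e <= t.
Proof.
case: (leP t 0) => [|t0]; first by left.
case: (leP (len e) t) => [|tl]; first by right.
by rewrite (edge_pt_in (introT andP (conj t0 tl))).
Qed.

Definition start p d : R :=
  match p with
  | inl _ => if d.2 then 0 else len d.1
  | inr x => (val x).2
  end.

Definition shift (b : bool) (t h : R) : R := if b then t + h else t - h.

Lemma moveE p d h : move p d h = edge_pt d.1 (shift d.2 (start p d) h).
Proof. by case: p. Qed.

(** Length of the edge left in front of [p] in direction [d]. For 0 < h < [ahead p d], the point
    [move p d h] is interior to the edge and determines [h]. *)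
Definition ahead p d : R :=
  if d.2 then len d.1 - start p d else start p d.

Lemma ahead_gt0 p d : d \in directions p -> 0 < ahead p d.
Proof.
case: p => [x|[[e t] etP]]; rewrite inE /ahead /=.
  by case: d => e [] /= _; rewrite ?subr0 len_gt0.
have /andP[/= t0 tl] := etP; by case: d => e' [] /= /eqP E; rewrite ?E ?subr_gt0.
Qed.

Lemma startP p d : d \in directions p -> edge_pt d.1 (start p d) = p.
Proof.
case: p => [x|[[e t] /= etP]]; rewrite inE /=.
  by case: d => e [] /= /eqP <-; [rewrite edge_pt_le0|rewrite edge_pt_ge].
by move=> /eqP ->; rewrite (edge_pt_in etP).
Qed.

Lemma start_bounds p d : d \in directions p -> 0 <= start p d <= len d.1.
Proof.
case: p => [x|[[e t] etP]]; rewrite inE /=.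
  by case: d => e [] /= _; rewrite lexx ltW // len_gt0.
by have /andP[/= t0 tl] := etP; move=> /eqP ->; rewrite !ltW.
Qed.

Lemma move0 p d : d \in directions p -> move p d 0 = p.
Proof. by move=> dp; rewrite moveE /shift addr0 subr0 if_same startP. Qed.

Lemma shift_in p d h : d \in directions p -> 0 < h -> h < ahead p d ->
  0 < shift d.2 (start p d) h < len d.1.
Proof.
move=> dp h0; have := start_bounds dp; rewrite /shift /ahead.
by case: d.2 => /andP[? ?] ?; apply/andP; split; lra.
Qed.

Definition rev d : edge G * bool := (d.1, ~~ d.2).

Lemma directions_inside e (t : R) : 0 < t -> t < len e ->
  directions (edge_pt e t : pt) = [set (e, true); (e, false)]%SET.
Proof.
move=> t0 tl; rewrite (edge_pt_in (introT andP (conj t0 tl))) /=.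
by apply/setP => -[e' b]; rewrite !inE /= !xpair_eqE; case: b; rewrite ?andbT ?andbF ?orbF.
Qed.

Lemma start_inside e (t : R) (b : bool) : 0 < t -> t < len e ->
  start (edge_pt e t : pt) (e, b) = t.
Proof. by move=> t0 tl; rewrite (edge_pt_in (introT andP (conj t0 tl))). Qed.

Lemma move_inside e (t : R) (b : bool) h : 0 < t -> t < len e ->
  move (edge_pt e t : pt) (e, b) h = edge_pt e (shift b t h).
Proof. by move=> t0 tl; rewrite moveE /= start_inside. Qed.

Lemma directions_move p d h : d \in directions p -> 0 < h -> h < ahead p d ->
  directions (move p d h) = [set d; rev d]%SET.
Proof.
move=> dp h0 hl; have /andP[? ?] := shift_in dp h0 hl.
rewrite moveE directions_inside //; rewrite [in RHS](surjective_pairing d) /rev.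
by case: d.2 => //=; rewrite finset.setUC.
Qed.

Lemma move_move p d h k : d \in directions p -> 0 < h -> h < ahead p d ->
  move (move p d h) d k = move p d (h + k).
Proof.
move=> dp h0 hl; have /andP[t0 tl] := shift_in dp h0 hl.
have := move_inside d.2 k t0 tl; rewrite -surjective_pairing -moveE => ->.
by rewrite moveE /shift; case: d.2; congr edge_pt; ring.
Qed.

Lemma move_rev p d h k : d \in directions p -> 0 < h -> h < ahead p d ->
  move (move p d h) (rev d) k = move p d (h - k).
Proof.
move=> dp h0 hl; have /andP[t0 tl] := shift_in dp h0 hl.
have := move_inside (~~ d.2) k t0 tl; rewrite -moveE => ->.
by rewrite moveE /shift /=; case: d.2 => /=; congr edge_pt; ring.
Qed.

Lemma move_inj p d h p' d' h' : d \in directions p -> 0 < h -> h < ahead p d ->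
  d' \in directions p' ->
  move p d h = move p' d' h' ->
  d.1 = d'.1 /\ shift d.2 (start p d) h = shift d'.2 (start p' d') h'.
Proof.
move=> dp h0 hl dp' E; have /andP[? ?] := shift_in dp h0 hl.
by move: E; rewrite !moveE => /edge_pt_eq; apply.
Qed.

Lemma dir_edge p d : d \in directions p -> exists2 t : R,
  0 <= t <= len d.1 & [/\ p = edge_pt d.1 t, start p d = t &
   (if d.2 then t < len d.1 else 0 < t)].
Proof.
move=> dp; exists (start p d); first exact: start_bounds.
split=> //; first by rewrite startP.
by have := ahead_gt0 dp; rewrite /ahead; case: d.2; rewrite ?subr_gt0.
Qed.

Lemma edge_dir e (t : R) (b : bool) : 0 <= t <= len e ->
  (if b then t < len e else 0 < t) ->
  (e, b) \in directions (edge_pt e t : pt) /\ start (edge_pt e t : pt) (e, b) = t.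
Proof.
move=> /andP[]; rewrite le_eqVlt => /orP[/eqP <-|t0].
  move=> _; rewrite edge_pt_le0 // inE /=; case: b; rewrite ?ltxx //= => _.
rewrite le_eqVlt => /orP[/eqP ->|tl].
  by rewrite edge_pt_ge // inE /=; case: b; rewrite ?ltxx //= => _.
move=> _; rewrite directions_inside // start_inside // !inE !xpair_eqE eqxx.
by case: b.
Qed.

Lemma edge_pt_continuous e : continuous (edge_pt e : R -> pt).
Proof.
apply/continuousP => U; rewrite point_openE => oU; exact: oU.
Qed.

Lemma move_nbhs p S d : d \in directions p -> nbhs p S ->
  \forall h \near 0^'+, S (move p d h).
Proof.
move=> dp; rewrite nbhsE => -[U [oU Up] US].
have [t t_in [pE stE tb]] := dir_edge dp.
have : nbhs t (edge_pt d.1 @^-1` U).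
  move: oU; rewrite /open_nbhs point_openE => /(_ d.1) oU.
  by apply: open_nbhs_nbhs; split => //=; rewrite -pE.
move=> /nbhs_ballP [eps /= e0 H]; apply/near0P; exists eps => // h h0 he.
apply: US; rewrite moveE; apply: H; rewrite /ball/= stE /shift.
by case: d.2; rewrite ?opprD ?opprK ?addrA ?subrr ?sub0r ?add0r ?normrN gtr0_norm.
Qed.

Definition star p (eps : R) : set pt :=
  [set q | q = p \/ exists d h, [/\ d \in directions p, 0 < h, h < eps & q = move p d h]].

(** The bound by [ahead] keeps the star away from the far ends, and there are no loops, so its
    preimage under each [edge_pt e] is empty or a single open interval. At a vertex this is a
    half-line, because [edge_pt] is constant beyond the ends of an edge. *)
Lemma star_open p eps : 0 < eps -> (forall d, d \in directions p -> eps < ahead p d) ->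
  open (star p eps).
Proof.
move=> eps0 epsP; rewrite point_openE => e.
case: p epsP => [x|[[e0 t0] /= et0]] epsP; last first.
  have [<-|ne] := eqVneq e0 e; last first.
    rewrite (_ : _ @^-1` _ = set0); first exact: open0.
    have /andP[/= a b] := et0.
    rewrite -subset0 => s /= [|[d [h [dp h0 he]]]].
      rewrite -(edge_pt_in et0) => /esym /(edge_pt_eq a b) [ee _].
      by rewrite ee eqxx in ne.
    have /andP[a' b'] := shift_in dp h0 (lt_trans he (epsP _ dp)).
    rewrite moveE => /esym /(edge_pt_eq a' b') [ee _].
    by move: dp; rewrite inE /= ee eq_sym (negbTE ne).
  rewrite (_ : _ @^-1` _ = `]t0 - eps, t0 + eps[%classic); first exact: interval_open.
  have /andP[a b] := et0.
  have l1 : eps < len e0 - t0.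
    by have := epsP (e0, true); rewrite inE /= => /(_ (eqxx _)).
  have l2 : eps < t0.
    by have := epsP (e0, false); rewrite inE /= => /(_ (eqxx _)).
  apply/seteqP; split=> s /=; rewrite in_itv /=.
    move=> [|[d [h [dp h0 he]]]].
      rewrite -(edge_pt_in et0) => /esym /edge_pt_eq [] // _ <-.
      by apply/andP; split; lra.
    have /andP[a' b'] := shift_in dp h0 (lt_trans he (epsP _ dp)).
    rewrite moveE => /esym /edge_pt_eq [] // _ <-.
    by rewrite /shift; case: d.2 => /=; apply/andP; split; lra.
  move=> /andP[s1 s2]; have [st|st|->] := ltgtP s t0.
  - right; exists (e0, false), (t0 - s); split; [by rewrite inE|lra|lra|].
    by rewrite moveE /=; congr edge_pt; lra.
  - right; exists (e0, true), (s - t0); split; [by rewrite inE|lra|lra|].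
    by rewrite moveE /=; congr edge_pt; lra.
  - by left; rewrite (edge_pt_in et0).
have [sx|sx] := eqVneq (src e) x.
  have el : eps < len e.
    by have := epsP (e, true); rewrite inE /= sx /ahead/= subr0 => /(_ (eqxx _)).
  rewrite (_ : _ @^-1` _ = `]-oo, eps[%classic); first exact: interval_open.
  apply/seteqP; split=> s /=; rewrite in_itv /=.
    move=> [/[dup] Es /edge_pt_vertex [s0|s1]|[d [h [dp h0 he]]]]; first lra.
      move: Es; rewrite edge_pt_ge // => -[] Es.
      by have := src_neq_tgt e; rewrite sx Es eqxx.
    have /andP[a' b'] := shift_in dp h0 (lt_trans he (epsP _ dp)).
    rewrite moveE => /esym /edge_pt_eq [] // de <-.
    move: dp he; rewrite inE /shift /=; case: d.2 => /=; first by lra.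
    by move=> /eqP; rewrite de -sx => /esym/eqP; rewrite (negbTE (src_neq_tgt e)).
  move=> s1; case: (leP s 0) => s0; first by left; rewrite edge_pt_le0 // sx.
  right; exists (e, true), s; split; rewrite ?inE ?sx //.
  by rewrite moveE /= add0r.
have [tx|tx] := eqVneq (tgt e) x.
  have el : eps < len e.
    by have := epsP (e, false); rewrite inE /= tx /ahead/= => /(_ (eqxx _)).
  rewrite (_ : _ @^-1` _ = `]len e - eps, +oo[%classic); first exact: interval_open.
  apply/seteqP; split=> s /=; rewrite in_itv /= ?andbT.
    move=> [/[dup] Es /edge_pt_vertex [s0|s1]|[d [h [dp h0 he]]]]; last first.
    - have /andP[a' b'] := shift_in dp h0 (lt_trans he (epsP _ dp)).
      rewrite moveE => /esym /edge_pt_eq [] // de <-.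
      move: dp he; rewrite inE /shift /= de; case: d.2 => /=; last by lra.
      by rewrite (negbTE sx).
    - by lra.
    - by move: Es; rewrite edge_pt_le0 // => -[] Es; rewrite Es eqxx in sx.
  move=> s1; case: (leP (len e) s) => s0; first by left; rewrite edge_pt_ge // tx.
  right; exists (e, false), (len e - s); split; [by rewrite inE /= tx|lra|lra|].
  by rewrite moveE /=; congr edge_pt; lra.
rewrite (_ : _ @^-1` _ = set0); first exact: open0.
rewrite -subset0 => s /= [/[dup] E /edge_pt_vertex [s0|s1]|[d [h [dp h0 he]]]].
- by move: E; rewrite edge_pt_le0 // => -[] E; rewrite E eqxx in sx.
- by move: E; rewrite edge_pt_ge // => -[] E; rewrite E eqxx in tx.
- have /andP[a' b'] := shift_in dp h0 (lt_trans he (epsP _ dp)).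
  rewrite moveE => /esym /edge_pt_eq [] // de _; move: dp; rewrite inE de.
  by case: d.2; rewrite ?(negbTE sx) ?(negbTE tx).
Qed.

Lemma near0_dirs p (P : edge G * bool -> R -> Prop) :
  (forall d, d \in directions p -> \forall h \near 0^'+, P d h) ->
  exists2 eps : R, 0 < eps &
   forall d h, d \in directions p -> 0 < h -> h < eps -> P d h.
Proof.
move=> H.
have [|eps epsP] := @choice _ _ (fun d (e : R) => 0 < e /\
    (d \in directions p -> forall h, 0 < h -> h < e -> P d h)).
  move=> d; have [dp|dp] := boolP (d \in directions p).
    by have /near0P [e e0 He] := H _ dp; exists e; split=> // _; apply: He.
  by exists 1; split.
exists (\big[Num.min/1]_(d : edge G * bool) eps d).
  by elim/big_ind : _ => // [x y x0 y0|d _]; [rewrite lt_min x0|case: (epsP d)].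
move=> d h dp h0 he; have [_ /(_ dp)] := epsP d; apply=> //.
by apply: lt_le_trans he _; exact: bigmin_le_cond.
Qed.

(** Reduces the topology to germs. A common radius exists because a point has finitely many
    directions, and the star of that radius is open. *)
Lemma point_nbhsP p S : nbhs p S <->
  S p /\ forall d, d \in directions p -> \forall h \near 0^'+, S (move p d h).
Proof.
split=> [pS|[Sp H]].
  by split; [exact: nbhs_singleton|move=> d dp; exact: move_nbhs].
have [eps eps0 epsP] : exists2 eps : R, 0 < eps &
   forall d h, d \in directions p -> 0 < h -> h < eps -> h < ahead p d /\ S (move p d h).
  apply: near0_dirs => d dp; near=> h; split.
    by near: h; apply: near0_lt; exact: ahead_gt0.
  by near: h; exact: H.
have o : open (star p (eps / 2)).
  apply: star_open; first by lra.
  by move=> d dp; apply: (proj1 (epsP _ _ dp _ _)); lra.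
rewrite nbhsE; exists (star p (eps / 2)).
  by split => //; left.
move=> q [->//|[d [h [dp h0 he ->]]]].
by apply: (proj2 (epsP _ _ dp _ _)); lra.
Unshelve. all: by end_near. Qed.

End Points.

(** * Connected sets seen through germs *)

Section Connectivity.
Variables (R : realType) (G : metric_graph R).
Local Notation pt := (mg_point G).
Implicit Types (e : edge G) (p q : pt) (d : edge G * bool).
Implicit Types (S T Z C U W : set pt).

Lemma point_openP S : open S <-> (forall p d, S p -> d \in directions p ->
  \forall h \near 0^'+, S (move p d h)).
Proof.
rewrite openE; split=> [oS p d Sp|H p Sp].
  by have /point_nbhsP[_] := oS _ Sp; apply.
by apply/point_nbhsP; split => // d; exact: H.
Qed.

(** Says that the trace of [C] is open and closed in [Z]; moves that leave [Z] are not
    constrained. *)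
Definition locally_constant_on Z C := forall p d, Z p -> d \in directions p ->
  \forall h \near 0^'+, Z (move p d h) -> (C (move p d h) <-> C p).

Lemma connected_locally_constant Z C : connected Z ->
  locally_constant_on Z C -> Z `&` C !=set0 -> Z `<=` C.
Proof.
move=> cZ lc ZC0; suff <- : Z `&` C = Z by exact: subIsetr.
apply: cZ => //.
  (* The interiors of C ∪ ~Z and of ~C ∪ ~Z cut [Z] exactly into its points in [C] and its points
     outside. *)
  exists (C `|` ~` Z)°; first exact: open_interior.
  apply/seteqP; split=> p [Zp H]; split=> //; last first.
    by have [] := interior_subset H.
  apply/point_nbhsP; split; first by left.
  move=> d dp; apply: filterS (lc _ _ Zp dp) => h H'.
  by have [/H' hC|] := pselect (Z (move p d h)); [left; apply/hC|right].
exists (~` (~` C `|` ~` Z)°); first exact/open_closedC/open_interior.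
apply/seteqP; split=> p [Zp H]; split=> //.
  by move=> /interior_subset[].
apply: contrapT => nC; apply: H; apply/point_nbhsP; split; first by left.
move=> d dp; apply: filterS (lc _ _ Zp dp) => h H'.
by have [/H' hC|] := pselect (Z (move p d h)); [left => /hC|right].
Qed.

Lemma move_continuous p d : continuous (move p d).
Proof.
move=> h; have -> : move p d = edge_pt d.1 \o shift d.2 (start p d).
  by apply/funext => x /=; rewrite moveE.
apply: continuous_comp; last exact: edge_pt_continuous.
rewrite /shift; case: d.2.
  by apply: cvgD; [exact: cvg_cst|exact: cvg_id].
by apply: cvgB; [exact: cvg_cst|exact: cvg_id].
Qed.

Lemma segment_connected p d (I : set R) : is_interval I ->
  connected (move p d @` I).
Proof.
move=> /connected_intervalP cI; apply: connected_continuous_connected cI _.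
by apply: continuous_subspaceT; exact: move_continuous.
Qed.

Lemma subset_component A p Z q : connected Z -> Z `<=` A -> Z q ->
  connected_component A p q -> Z `<=` connected_component A (p : pt).
Proof.
move=> cZ ZA Zq pq; rewrite (same_connected_component pq).
exact: connected_component_max.
Qed.

Lemma segment_near p d q d' (k : R) : d \in directions p -> d' \in directions q ->
  k < ahead p d -> (forall h, 0 <= h -> h <= k -> q <> move p d h) ->
  \forall h' \near 0^'+, forall h, 0 < h -> h < k -> move q d' h' <> move p d h.
Proof.
move=> dp dq ka H.
have [ee|ne] := eqVneq d.1 d'.1; last first.
  apply: nearW => h' h h0 hk /esym E.
  have [ee _] := move_inj dp h0 (lt_trans hk ka) dq E.
  by rewrite ee eqxx in ne.
have [k0|k0] := ltP k 0; first by apply: nearW => h' h h0 hk; exfalso; lra.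
(* Signed coordinate of [q] along [d], counted from [p]; it lies at a positive distance from
   [0, k]. *)
pose x := if d.2 then start q d' - start p d else start p d - start q d'.
have qE : q = move p d x.
  by rewrite moveE /x -{1}(startP dq) ee /shift; case: d.2; congr edge_pt; lra.
have [eps eps0 epsP] : exists2 eps : R, 0 < eps & (x <= - eps \/ k + eps <= x).
  have [x0|x0] := ltP x 0; first by exists (- x); [lra|left; lra].
  have [xk|xk] := leP x k; first by have := H _ x0 xk.
  by exists (x - k); [lra|right; lra].
apply/near0P; exists eps => // h' h'0 he h h0 hk /esym E.
have [_] := move_inj dp h0 (lt_trans hk ka) dq E.
by case: epsP; rewrite /shift /x; case: d.2; case: d'.2; lra.
Qed.

Definition open_segment p d (k : R) : set pt :=
  [set q | exists h, [/\ 0 < h, h < k & q = move p d h]].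

Lemma open_segment_open p d k : d \in directions p -> k <= ahead p d ->
  open (open_segment p d k).
Proof.
move=> dp ka; apply/point_openP => q d' [h [h0 hk ->]].
have ha := lt_le_trans hk ka.
rewrite directions_move // !inE => /orP[] /eqP ->; near=> x.
  rewrite move_move //; exists (h + x); split=> //.
    by apply: addr_gt0 => //; near: x; exact: near0_gt.
  by rewrite -ltrBrDl; near: x; apply: near0_lt; rewrite subr_gt0.
rewrite move_rev //; exists (h - x); split=> //.
  by rewrite subr_gt0; near: x; exact: near0_lt.
by rewrite ltrBlDr ltr_wpDr //; apply/ltW; near: x; exact: near0_gt.
Unshelve. all: by end_near. Qed.

Lemma open_segment_far p d k q d' : d \in directions p -> k < ahead p d ->
  d' \in directions q -> q <> p -> q <> move p d k -> ~ open_segment p d k q ->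
  \forall h \near 0^'+, ~ open_segment p d k (move q d' h).
Proof.
move=> dp ka dq qp qk nq.
have H h : 0 <= h -> h <= k -> q <> move p d h.
  rewrite le_eqVlt => /orP[/eqP <- _|h0]; first by rewrite move0.
  rewrite le_eqVlt => /orP[/eqP -> //|hk] E.
  by apply: nq; exists h.
have := segment_near dp dq ka H.
by apply: filterS => x Hx [h [h0 hk E]]; apply: (Hx h).
Qed.

(** An open segment can only be left through its two ends, which [Z] misses. *)
Lemma open_segment_locally_constant Z p d k : d \in directions p -> k < ahead p d ->
  ~ Z p -> ~ Z (move p d k) -> locally_constant_on Z (open_segment p d k).
Proof.
move=> dp ka nZp nZk q d' Zq dq; have [Oq|nOq] := pselect (open_segment p d k q).
  have /point_openP oO := open_segment_open dp (ltW ka).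
  by apply: filterS (oO _ _ Oq dq) => h Oh _.
have qp : q <> p by move=> E; apply: nZp; rewrite -E.
have qk : q <> move p d k by move=> E; apply: nZk; rewrite -E.
by apply: filterS (open_segment_far dp ka dq qp qk nOq) => h nOh _.
Qed.

Lemma move_injl p d h h' : d \in directions p -> 0 < h -> h < ahead p d ->
  move p d h = move p d h' -> h = h'.
Proof.
move=> dp h0 ha E; have [_] := move_inj dp h0 ha dp E.
by rewrite /shift; case: d.2; lra.
Qed.

(** If [U] came and went near [p], a missing point [move p d k] would have points of [U] on both
    sides. The segment from [p] to it would be clopen in [U] and contain some but not all of [U]. *)
Lemma connected_germ U p d : connected U -> ~ U p -> d \in directions p ->
  (\forall h \near 0^'+, U (move p d h)) \/
  (\forall h \near 0^'+, ~ U (move p d h)).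
Proof.
move=> cU Up dp.
have [far|nfar] := pselect (\forall h \near 0^'+, ~ U (move p d h)).
  by right.
left.
have close (a : R) : 0 < a -> exists h, [/\ 0 < h, h < a & U (move p d h)].
  move=> a0; apply: contrapT => H; apply: nfar; apply/near0P; exists a => // h h0 he Uh.
  by apply: H; exists h.
have [h0 [h00 h0a Uh0]] := close _ (ahead_gt0 dp).
apply/near0P; exists h0 => // k k0 kh0; apply: contrapT => nUk.
have [h2 [h20 h2k Uh2]] := close _ k0.
have ka := lt_trans kh0 h0a.
have lc := open_segment_locally_constant dp ka Up nUk.
have /(_ (move p d h0) Uh0) [h [h0' hk E]] : U `<=` open_segment p d k.
  apply: connected_locally_constant cU lc _.
  by exists (move p d h2); split => //; exists h2.
by move: hk; rewrite -(move_injl dp h00 h0a E); lra.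
Qed.

Lemma locally_constantP Z C p q : connected Z -> locally_constant_on Z C ->
  Z p -> Z q -> C p <-> C q.
Proof.
move=> cZ lc Zp Zq.
have H x y : Z x -> Z y -> C x -> C y.
  move=> Zx Zy Cx; apply: (connected_locally_constant cZ lc) => //.
  by exists x.
by split; exact: H.
Qed.

Lemma locally_constant_sub Z Z' C : Z `<=` Z' ->
  locally_constant_on Z' C -> locally_constant_on Z C.
Proof.
move=> ZZ lc p d Zp dp; apply: filterS (lc p d (ZZ _ Zp) dp) => h H /ZZ.
exact: H.
Qed.

Lemma near0_ex (P : R -> Prop) : (\forall h \near 0^'+, P h) ->
  exists2 h, 0 < h & P h.
Proof.
move=> /near0P[eps e0 H]; exists (eps / 2); first by lra.
by apply: H; lra.
Qed.

Lemma near0_absurd (P : R -> Prop) : (\forall h \near 0^'+, P h) ->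
  (\forall h \near 0^'+, ~ P h) -> False.
Proof.
move=> /near0P[a a0 HP] /near0P[b b0 HN].
have [ab|ba] := ltP a b.
  by apply: (HN (a / 2)); [lra|lra|apply: HP; lra].
by apply: (HN (b / 2)); [lra|lra|apply: HP; lra].
Qed.

Lemma near_neq p d q : d \in directions p ->
  \forall h \near 0^'+, move p d h <> q.
Proof.
move=> dp.
have [|H] := pselect (exists h, 0 < h < ahead p d /\ move p d h = q); last first.
  near=> h => E; apply: H; exists h; split => //; apply/andP; split; near: h.
    exact: near0_gt.
  by apply: near0_lt; exact: ahead_gt0.
move=> [k [/andP[k0 ka] <-]]; near=> h.
have h0 : 0 < h by near: h; exact: near0_gt.
have hk : h < k by near: h; exact: near0_lt.
move=> E; have [_] := move_inj dp h0 (lt_trans hk ka) dp E.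
by rewrite /shift; case: d.2; lra.
Unshelve. all: by end_near. Qed.

End Connectivity.

(** * Piecewise linear functions through their outgoing slopes *)

Section PiecewiseLinear.
Variables (R : realType) (G : metric_graph R).
Local Notation pt := (mg_point G).
Implicit Types (e : edge G) (p q : pt) (d : edge G * bool) (f g : pt -> R).

Definition has_slope f p d (m : int) :=
  \forall h \near 0^'+, f (move p d h) = f p + m%:~R * h.

(** Germ form of [rational_function]: continuity and the finite partitions are consequences, see
    [rational_functionP]. *)
Definition pl f := forall p d, d \in directions p -> exists m, has_slope f p d m.

Lemma affine_germ_inj (a : R) (m n : R) (u : R -> R) :
  (\forall h \near 0^'+, u h = a + m * h) ->
  (\forall h \near 0^'+, u h = a + n * h) -> m = n.
Proof.
move=> Hm Hn; have : \forall h \near (0 : R)^'+,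
    [/\ u h = a + m * h, u h = a + n * h & 0 < h].
  near=> h; split; [by near: h|by near: h|by near: h; exact: near0_gt].
move=> /near0_ex[h _ [H1 H2 h0]].
by move: H1; rewrite H2 => /addrI /(mulIf (lt0r_neq0 h0)).
Unshelve. all: by end_near. Qed.

Lemma has_slope_inj f p d m n : has_slope f p d m -> has_slope f p d n -> m = n.
Proof. by move=> Hm Hn; apply/eqP; rewrite -(eqr_int R); apply/eqP; exact: affine_germ_inj Hm Hn. Qed.

Lemma slopeE f p d m : has_slope f p d m -> slope f p d = m.
Proof.
move=> H; have ex : exists x, [set m : int | has_slope f p d m] x by exists m.
exact: has_slope_inj (xgetPex 0 ex) H.
Qed.

Lemma plP f p d : pl f -> d \in directions p -> has_slope f p d (slope f p d).
Proof. by move=> plf dp; have [m Hm] := plf _ _ dp; rewrite (slopeE Hm). Qed.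

Lemma has_slopeD f g p d m n : has_slope f p d m -> has_slope g p d n ->
  has_slope (fun q => f q + g q) p d (m + n).
Proof. by apply: filterS2 => h -> ->; rewrite intrD; ring. Qed.

Lemma has_slopeN f p d m : has_slope f p d m ->
  has_slope (fun q => - f q) p d (- m).
Proof. by apply: filterS => h ->; rewrite intrN; ring. Qed.

Lemma has_slope_cst (c : R) p d : has_slope (fun=> c) p d 0.
Proof. by apply: nearW => h; rewrite mul0r addr0. Qed.

Lemma near0_affine_gt (a b : R) : 0 < a ->
  \forall h \near 0^'+, 0 < a + b * h.
Proof.
move=> a0; apply/near0P; exists (a / (1 + `|b|)).
  by rewrite divr_gt0 // ltr_pwDl.
have b1 : 0 < 1 + `|b| by rewrite ltr_pwDl.
move=> h h0; rewrite ltr_pdivlMr // => H.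
have := ler_norm (- b); rewrite normrN -(ler_pM2r h0) => Hb.
lra.
Qed.

Lemma affine_germ_max (u v : R -> R) (a b : R) (m n : int) :
  (\forall h \near 0^'+, u h = a + m%:~R * h) ->
  (\forall h \near 0^'+, v h = b + n%:~R * h) ->
  \forall h \near 0^'+, Num.max (u h) (v h) = Num.max a b +
    (if a == b then Num.max m n else if a < b then n else m)%:~R * h.
Proof.
move=> Hu Hv; case: eqP => [ab|/eqP ne].
  near=> h; have h0 : 0 < h by near: h; exact: near0_gt.
  have -> : u h = a + m%:~R * h by near: h.
  have -> : v h = b + n%:~R * h by near: h.
  rewrite ab maxxx -addr_maxr; congr (_ + _).
  have H (x y : int) : x <= y -> x%:~R * h <= y%:~R * h by rewrite ler_pM2r // ler_int.
  by case: (leP m n) => [/H/max_idPr //|/ltW/H/max_idPl].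
case: ltP => ab.
  have := near0_affine_gt (n%:~R - m%:~R) (eq_trans (subr_gt0 a b) ab).
  apply: filterS3 Hu Hv => h -> -> H.
  by apply/max_idPr; lra.
have {}ab : b < a by rewrite lt_neqAle eq_sym ne.
have := near0_affine_gt (m%:~R - n%:~R) (eq_trans (subr_gt0 b a) ab).
apply: filterS3 Hu Hv => h -> -> H.
by apply/max_idPl; lra.
Unshelve. all: by end_near. Qed.

Lemma has_slope_max f g p d m n : has_slope f p d m -> has_slope g p d n ->
  has_slope (fun q => Num.max (f q) (g q)) p d
    (if f p == g p then Num.max m n else if f p < g p then n else m).
Proof. exact: affine_germ_max. Qed.

Lemma pl_cst (c : R) : pl (fun=> c).
Proof. by move=> p d _; exists 0; exact: has_slope_cst. Qed.

Lemma plD f g : pl f -> pl g -> pl (fun q => f q + g q).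
Proof. by move=> F H p d dp; eexists; apply: has_slopeD; exact: plP. Qed.

Lemma plN f : pl f -> pl (fun q => - f q).
Proof. by move=> F p d dp; eexists; apply: has_slopeN; exact: plP. Qed.

Lemma pl_max f g : pl f -> pl g -> pl (fun q => Num.max (f q) (g q)).
Proof. by move=> F H p d dp; eexists; apply: has_slope_max; exact: plP. Qed.

Lemma slopeD f g p d : pl f -> pl g -> d \in directions p ->
  slope (fun q => f q + g q) p d = slope f p d + slope g p d.
Proof. by move=> F H dp; apply/slopeE/has_slopeD; exact: plP. Qed.

Lemma ordD f g p : pl f -> pl g -> ord (fun q => f q + g q) p = ord f p + ord g p.
Proof.
by move=> F H; rewrite /ord -big_split /=; apply: eq_bigr => d dp; rewrite slopeD.
Qed.

Lemma ordN f p : pl f -> ord (fun q => - f q) p = - ord f p.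
Proof.
move=> F; rewrite /ord (big_morph (@GRing.opp int) (@opprD int) (oppr0 _)).
by apply: eq_bigr => d dp; apply/slopeE/has_slopeN; exact: plP.
Qed.

Lemma ord_cst (c : R) p : ord (fun=> c) p = 0.
Proof. by rewrite /ord big1 // => d dp; apply/slopeE/has_slope_cst. Qed.

Lemma pl_continuous f : pl f -> continuous f.
Proof.
move=> F p; apply/(@cvgrPdist_lt _ _ _ (nbhs p) (nbhs_filter p)) => eps eps0; apply/point_nbhsP.
split; first by rewrite subrr normr0.
move=> d dp; have Hs := plP F dp; set m := slope f p d in Hs.
near=> h.
have -> : f (move p d h) = f p + m%:~R * h by near: h.
have H1 : 0 < eps + m%:~R * h by near: h; exact: near0_affine_gt.
have H2 : 0 < eps + (- m%:~R) * h by near: h; exact: near0_affine_gt.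
by rewrite ltr_norml; apply/andP; split; lra.
Unshelve. all: by end_near. Qed.

(** The affine germ at [p] is still affine around its nearby points, where looking back reverses the
    sign of the slope. *)
Lemma slope_rev f p d (m : int) : pl f -> d \in directions p -> has_slope f p d m ->
  \forall h \near 0^'+, slope f (move p d h) d = m /\ slope f (move p d h) (rev d) = - m.
Proof.
move=> F dp /near0P[a a0 Ha]; near=> h.
have h0 : 0 < h by near: h; exact: near0_gt.
have ha : h < a by near: h; exact: near0_lt.
have hl : h < ahead p d by near: h; apply: near0_lt; exact: ahead_gt0.
split; apply: slopeE.
  apply/near0P; exists (a - h); first by lra.
  by move=> k k0 ka; rewrite move_move // !Ha; [ring|lra..].
apply/near0P; exists h => // k k0 ka.
by rewrite move_rev // !Ha ?intrN; [ring|lra..].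
Unshelve. all: by end_near. Qed.

End PiecewiseLinear.

(** * From partitions of an interval to germs and back *)

Section Partitions.
Variable R : realType.
Implicit Types (g : R -> R) (a b t : R) (s : seq R).

Definition affine_pieces a b s g := forall i, (i < size s)%N -> exists m : int,
  forall t, t \in `[nth b (a :: s) i, nth b s i] ->
    g t = g (nth b (a :: s) i) + m%:~R * (t - nth b (a :: s) i).

Lemma affine_pieces_cons a b x s g : affine_pieces a b (x :: s) g ->
  (exists m : int, forall t, a <= t -> t <= x -> g t = g a + m%:~R * (t - a)) /\
  affine_pieces x b s g.
Proof.
move=> H; split.
  have [//|m Hm] := H 0; exists m => t at_ tx; apply: Hm.
  by rewrite in_itv /= at_.
by move=> i si; have [//|m Hm] := H i.+1; exists m.
Qed.

Lemma affine_germ_right a b s g : itv_partition a b s -> affine_pieces a b s g ->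
  forall t, a <= t -> t < b ->
  exists m : int, \forall h \near 0^'+, g (t + h) = g t + m%:~R * h.
Proof.
elim: s a => [|x s IH] a.
  by move=> /itv_partition_nil -> _ t bt; rewrite ltNge bt.
move=> /[dup] /itv_partition_cons ps [/= /andP[ax _] _] /affine_pieces_cons[[m Hm] Hs] t at_ tb.
have [tx|xt] := ltP t x; last exact: (IH x).
exists m; apply/near0P; exists (x - t); first by lra.
by move=> h h0 hx; rewrite (Hm (t + h)) ?(Hm t); [ring|lra..].
Qed.

Lemma affine_germ_left a b s g : itv_partition a b s -> affine_pieces a b s g ->
  forall t, a < t -> t <= b ->
  exists m : int, \forall h \near 0^'+, g (t - h) = g t + m%:~R * h.
Proof.
elim: s a => [|x s IH] a.
  by move=> /itv_partition_nil -> _ t bt; rewrite leNgt bt.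
move=> /[dup] /itv_partition_cons ps [/= /andP[ax _] _] /affine_pieces_cons[[m Hm] Hs] t at_ tb.
have [tx|xt] := leP t x; last exact: (IH x).
exists (- m); apply/near0P; exists (t - a); first by lra.
by move=> h h0 hx; rewrite (Hm (t - h)) ?(Hm t) ?intrN; [ring|lra..].
Qed.

Section Slopes.
Variables (g : R -> R) (rs ls : R -> int).

Definition right_slopes a b := forall t, a <= t -> t < b ->
  \forall h \near 0^'+, g (t + h) = g t + (rs t)%:~R * h.
Definition left_slopes a b := forall t, a < t -> t <= b ->
  \forall h \near 0^'+, g (t - h) = g t + (ls t)%:~R * h.

Lemma slope_affine_right a x (m : int) t :
  (forall t, a <= t -> t <= x -> g t = g a + m%:~R * (t - a)) ->
  a <= t -> t < x ->
  (\forall h \near 0^'+, g (t + h) = g t + (rs t)%:~R * h) -> rs t = m.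
Proof.
move=> Hm at_ tx H; apply/eqP; rewrite -(eqr_int R); apply/eqP.
apply: affine_germ_inj H _; apply/near0P; exists (x - t); first lra.
by move=> h h0 hx; rewrite (Hm (t + h)) ?(Hm t); [ring|lra..].
Qed.

Lemma slope_affine_left a x (m : int) t :
  (forall t, a <= t -> t <= x -> g t = g a + m%:~R * (t - a)) ->
  a < t -> t <= x ->
  (\forall h \near 0^'+, g (t - h) = g t + (ls t)%:~R * h) -> ls t = - m.
Proof.
move=> Hm at_ tx H; apply/eqP; rewrite -(eqr_int R); apply/eqP.
apply: affine_germ_inj H _; apply/near0P; exists (t - a); first lra.
by move=> h h0 hx; rewrite (Hm (t - h)) ?(Hm t) ?intrN; [ring|lra..].
Qed.

(** An affine piece of slope m contributes m at its left end and -m at its right end. *)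
Lemma sum_slopes_eq0 a b s : right_slopes a b -> left_slopes a b ->
  itv_partition a b s -> affine_pieces a b s g ->
  \sum_(t <- belast a s) rs t + \sum_(t <- s) ls t = 0.
Proof.
elim: s a => [|x s IH] a Hr Hl; first by rewrite !big_nil.
move=> /[dup] /itv_partition_cons ps [/= /andP[ax _] _] /affine_pieces_cons[[m Hm] Hs].
have xb := itv_partition_le ps.
rewrite /= !big_cons (slope_affine_right Hm (lexx a) ax); last by apply: Hr => //; lra.
rewrite (slope_affine_left Hm ax (lexx x)); last exact: Hl.
have := IH x _ _ ps Hs => {}IH; have {}IH := IH _ _.
rewrite -[RHS]IH; last 2 first.
- by move=> t xt tb; apply: Hr => //; lra.
- by move=> t xt tb; apply: Hl => //; lra.
by rewrite addrACA subrr add0r.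
Qed.

Lemma slopes_cancel a b s t : right_slopes a b -> left_slopes a b ->
  itv_partition a b s -> affine_pieces a b s g ->
  a < t -> t < b -> t \notin s -> rs t + ls t = 0.
Proof.
elim: s a => [|x s IH] a Hr Hl.
  by move=> /itv_partition_nil -> _ bt /(lt_trans bt); rewrite ltxx.
move=> /[dup] /itv_partition_cons ps [/= /andP[ax _] _] /affine_pieces_cons[[m Hm] Hs] at_ tb.
rewrite inE negb_or => /andP[tx ts].
move: tx; rewrite neq_lt => /orP[tx|xt].
  rewrite (slope_affine_right Hm (ltW at_) tx); last by apply: Hr => //; lra.
  rewrite (slope_affine_left Hm at_ (ltW tx)) ?subrr //; by apply: Hl => //; lra.
apply: (IH x) => //.
- by move=> u xu ub; apply: Hr => //; lra.
- by move=> u xu ub; apply: Hl => //; lra.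
Qed.

End Slopes.

Lemma piecewise_linear_extend g a t b (m : int) : a <= t -> t < b ->
  piecewise_linear_int a t g ->
  (forall u, t <= u -> u <= b -> g u = g t + m%:~R * (u - t)) ->
  piecewise_linear_int a b g.
Proof.
move=> at_ tb [s [[ps /eqP lst] Hs]] Hm; exists (rcons s b); split.
  by split; [rewrite rcons_path ps lst|rewrite last_rcons].
move=> i; rewrite size_rcons ltnS leq_eqVlt => /orP[/eqP ->|si].
  exists m => u; rewrite -rcons_cons nth_rcons /= ltnS leqnn nth_rcons ltnn eqxx.
  have -> : nth b (a :: s) (size s) = t.
    by have /= -> := nth_last b (a :: s).
  by rewrite in_itv /= => /andP[tu ub]; exact: Hm.
have [n Hn] := Hs _ si; exists n => u.
rewrite -rcons_cons nth_rcons /= ltnS (ltnW si) nth_rcons si.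
rewrite (set_nth_default t b (s := a :: s)) /= ?ltnS ?(ltnW si) //.
by rewrite (set_nth_default t b (s := s)) // => /Hn.
Qed.

(** Continuous induction on the end of the partition: a right germ extends it a little, a left germ
    adds the last piece before a limit point. *)
Lemma piecewise_linear_germs g a b : a <= b ->
  (forall t, a <= t -> t < b ->
    exists m : int, \forall h \near 0^'+, g (t + h) = g t + m%:~R * h) ->
  (forall t, a < t -> t <= b ->
    exists m : int, \forall h \near 0^'+, g (t - h) = g t + m%:~R * h) ->
  piecewise_linear_int a b g.
Proof.
move=> ab Hr Hl; apply: (real_induction (P := fun t => piecewise_linear_int a t g) ab).
- by exists [::]; split => //; split => /=.
- move=> t at_ tb Pt; have [m /near0P [eps eps0 Hm]] := Hr _ at_ tb.
  apply/near0P; exists eps => // h h0 he.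
  apply: (piecewise_linear_extend (m := m) at_ _ Pt); first lra.
  move=> u tu; rewrite le_eqVlt; move: tu; rewrite le_eqVlt => /orP[/eqP <-|tu] uh.
    by rewrite subrr mulr0 addr0.
  have -> : u = t + (u - t) by ring.
  rewrite Hm ?subr_gt0 //; last by case/orP: uh => [/eqP|]; lra.
  by congr (_ + _ * _); ring.
- move=> t at_ tb Ps; have [m /near0P [eps eps0 Hm]] := Hl _ at_ tb.
  pose s := Num.max a (t - eps / 2).
  have st : s < t by rewrite gt_max at_; lra.
  have as_ : a <= s by rewrite le_max lexx.
  have se : t - eps / 2 <= s by rewrite le_max lexx orbT.
  apply: (piecewise_linear_extend (m := - m) as_ st (Ps _ as_ st)).
  have H u : s <= u -> u <= t -> g u = g t + m%:~R * (t - u).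
    move=> su; rewrite le_eqVlt => /orP[/eqP ->|ut]; first by rewrite subrr mulr0 addr0.
    by rewrite -(Hm (t - u)); [congr g; ring|lra..].
  by move=> u su ut; rewrite (H u) // (H s) // ?intrN; [ring|lra].
- exact: ab.
- exact: lexx.
Qed.

(* Principal divisors and linear equivalence *)
End Partitions.

Section Rational.
Variables (R : realType) (G : metric_graph R).
Local Notation pt := (mg_point G).
Implicit Types (e : edge G) (p q : pt) (d : edge G * bool) (f g : pt -> R).

Lemma edge_forward e (t : R) : 0 <= t -> t < len e ->
  ((e, true) \in directions (edge_pt e t : pt)) /\
  forall h, move (edge_pt e t : pt) (e, true) h = edge_pt e (t + h).
Proof.
move=> t0 tl; have [||dE sE] := @edge_dir _ G e t true; rewrite ?t0 ?ltW //.
by split=> // h; rewrite moveE sE.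
Qed.

Lemma edge_backward e (t : R) : 0 < t -> t <= len e ->
  ((e, false) \in directions (edge_pt e t : pt)) /\
  forall h, move (edge_pt e t : pt) (e, false) h = edge_pt e (t - h).
Proof.
move=> t0 tl; have [||dE sE] := @edge_dir _ G e t false; rewrite ?tl ?ltW //.
by split=> // h; rewrite moveE sE.
Qed.

Lemma rational_functionP f : rational_function f <-> pl f.
Proof.
split=> [[_ H] p [e b] dp|plf]; last first.
  split; first exact: pl_continuous.
  move=> e; apply: piecewise_linear_germs; first exact/ltW/len_gt0.
    move=> t t0 tl; have [dp mE] := edge_forward t0 tl.
    have [m Hm] := plf _ _ dp; exists m; move: Hm; apply: filterS => h.
    by rewrite mE.
  move=> t t0 tl; have [dp mE] := edge_backward t0 tl.
  have [m Hm] := plf _ _ dp; exists m; move: Hm; apply: filterS => h.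
  by rewrite mE.
have [s [ps Hs]] := H e; case: b dp => dp.
  have [t /= /andP[t0 tl] [pE sE tb]] := dir_edge dp; rewrite pE.
  have [_ mE] := edge_forward t0 tb.
  have [m Hm] := affine_germ_right ps Hs t0 tb; exists m; move: Hm.
  by apply: filterS => h; rewrite mE.
have [t /= /andP[t0 tl] [pE sE tb]] := dir_edge dp; rewrite pE.
have [_ mE] := edge_backward tb tl.
have [m Hm] := affine_germ_left ps Hs tb tl; exists m; move: Hm.
by apply: filterS => h; rewrite mE.
Qed.

Lemma right_slopes_pl f e : pl f -> right_slopes (f \o edge_pt e)
  (fun t => slope f (edge_pt e t) (e, true)) 0 (len e).
Proof.
move=> plf t t0 tl; have [dp mE] := edge_forward t0 tl.
by have := plP plf dp; apply: filterS => h; rewrite mE.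
Qed.

Lemma left_slopes_pl f e : pl f -> left_slopes (f \o edge_pt e)
  (fun t => slope f (edge_pt e t) (e, false)) 0 (len e).
Proof.
move=> plf t t0 tl; have [dp mE] := edge_backward t0 tl.
by have := plP plf dp; apply: filterS => h; rewrite mE.
Qed.

Lemma ord_inside f e (t : R) : 0 < t -> t < len e ->
  ord f (edge_pt e t) = slope f (edge_pt e t) (e, true) + slope f (edge_pt e t) (e, false).
Proof.
by move=> t0 tl; rewrite /ord directions_inside // big_setU1 ?inE ?xpair_eqE ?eqxx // big_set1.
Qed.

(** Double counting: the directions at the vertices are the two ends of each edge. *)
Lemma sum_ord_vertices f : \sum_(x : vertex G) ord f (inl x) =
  \sum_e (slope f (inl (src e)) (e, true) + slope f (inl (tgt e)) (e, false)).
Proof.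
rewrite /ord (exchange_big_dep xpredT) //=.
rewrite [LHS](_ : _ = \sum_(d : edge G * bool)
    slope f (inl (if d.2 then src d.1 else tgt d.1)) (d.1, d.2)); last first.
  apply: eq_bigr => d _; rewrite -surjective_pairing.
  by rewrite (big_pred1 (if d.2 then src d.1 else tgt d.1)) // => x; rewrite inE eq_sym.
rewrite -(pair_bigA _ (fun e b => slope f (inl (if b then src e else tgt e)) (e, b))).
by apply: eq_bigr => e _; rewrite big_bool.
Qed.

Lemma pl_partition f e : pl f -> exists s : seq R,
  itv_partition 0 (len e) (rcons s (len e)) /\
  affine_pieces 0 (len e) (rcons s (len e)) (f \o edge_pt e).
Proof.
move=> /rational_functionP [_ /(_ e) [s [ps Hs]]].
case/lastP: s ps Hs => [/itv_partition_nil E|s x ps Hs].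
  by have := len_gt0 e; rewrite -E ltxx.
by exists s; move: (ps) => [_]; rewrite last_rcons => /eqP xl; rewrite -xl in ps Hs *.
Qed.

Lemma partition_inside e (s : seq R) : itv_partition 0 (len e) (rcons s (len e)) ->
  uniq s /\ forall t, t \in s -> 0 < t /\ t < len e.
Proof.
move=> [+ _]; rewrite (path_pairwise lt_trans) pairwise_cons pairwise_rcons.
rewrite all_rcons => /and3P[/andP[_ /allP H0] /allP H1 ps].
split; first by apply: lt_sorted_uniq; rewrite (sorted_pairwise lt_trans).
by move=> t ts; split; [exact: H0|exact: H1].
Qed.

(** Makes [principal f] a genuine finite sum of degree 0. The list consists of the vertices and the
    inner break points; regrouped by edges, the slopes cancel by [sum_slopes_eq0]. *)
Lemma pl_breakpoints f : pl f -> exists s : seq pt,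
  [/\ uniq s, forall p, p \notin s -> ord f p = 0 & \sum_(p <- s) ord f p = 0].
Proof.
move=> plf.
have [s Hs] := choice (fun e => pl_partition e plf).
have sU e : uniq (s e) by have [/partition_inside[]] := Hs e.
have sI e t : t \in s e -> 0 < t /\ t < len e.
  by have [/partition_inside[_ H] _] := Hs e; exact: H.
exists ([seq inl x | x <- enum (vertex G)] ++
  [seq edge_pt e t | e <- enum (edge G), t <- s e]); split.
- rewrite cat_uniq map_inj_uniq ?enum_uniq /=; last by move=> x y [].
  apply/andP; split.
    apply/hasPn => _ /allpairsPdep[e [t [_ /sI[t0 tl] ->]]].
    by rewrite (edge_pt_in (introT andP (conj t0 tl))); apply/mapP => -[].
  apply: allpairs_uniq_dep; rewrite ?enum_uniq // => -[e t] [e' t'] /=.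
  move=> /allpairsPdep[a [b [_ /sI[b0 bl] [-> /= E]]]] _.
  have {E} -> : t = b by [].
  by move=> /(edge_pt_eq b0 bl) [-> ->].
- case=> [x|x].
    by rewrite mem_cat map_f // mem_enum.
  rewrite mem_cat negb_or => /andP[_]; case: x => [[e t] etP].
  have /andP[/= t0 tl] := etP; rewrite -(edge_pt_in etP) => nin.
  have [ps Hp] := Hs e; rewrite ord_inside //.
  have /= := slopes_cancel (right_slopes_pl (e:=e) plf) (left_slopes_pl (e:=e) plf) ps Hp t0 tl.
  apply.
  rewrite mem_rcons inE negb_or lt_eqF //=.
  by apply: contra nin => ts; apply/allpairsPdep; exists e, t; rewrite mem_enum.
rewrite big_cat /= big_map big_allpairs_dep /= !big_enum /= sum_ord_vertices -big_split /=.
apply: big1 => e _; have [ps Hp] := Hs e.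
have := sum_slopes_eq0 (right_slopes_pl (e:=e) plf) (left_slopes_pl (e:=e) plf) ps Hp.
rewrite belast_rcons big_cons -cats1 big_cat big_seq1 /= => E.
rewrite [X in _ + X](_ : _ = \sum_(t <- s e) (slope f (edge_pt e t) (e, true)
   + slope f (edge_pt e t) (e, false))); last first.
  by rewrite !big_seq; apply: eq_bigr => t /sI[? ?]; exact: ord_inside.
rewrite big_split /= -[RHS]E edge_pt_le0 // edge_pt_ge //; ring.
Qed.

(** Has the shape of [principal], so that one computation of coefficients serves both for orders and
    for [fork_chips]. *)
Definition divisor_of (c : pt -> int) : divisor G :=
  \sum_(p \in [set: pt]) << c p *g p >>.

Lemma divisor_ofE (c : pt -> int) (s : seq pt) :
  uniq s -> (forall p, p \notin s -> c p = 0) ->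
  divisor_of c = \sum_(p <- s) << c p *g p >>.
Proof.
move=> us s0; rewrite /divisor_of (fsbigE s) //=.
  by apply: eq_bigl => p; exact: mem_setT.
by move=> p _ /s0 ->; exact: freegU0.
Qed.

Lemma coeff_divisor_of (c : pt -> int) (s : seq pt) :
  (forall p, p \notin s -> c p = 0) -> forall p, coeff p (divisor_of c) = c p.
Proof.
move=> s0 p; rewrite (@divisor_ofE _ (undup s)) ?undup_uniq //; last first.
  by move=> q; rewrite mem_undup; exact: s0.
rewrite raddf_sum /=; under eq_bigr do rewrite coeffU.
have [ps|ps] := boolP (p \in undup s).
  rewrite (bigD1_seq p) ?undup_uniq //= eqxx mulr1 big1 ?addr0 // => q /negbTE ->.
  by rewrite mulr0.
rewrite big_seq big1 ?s0 //; first by rewrite -mem_undup.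
move=> q qs; case: eqP => [qp|_]; last by rewrite mulr0.
by rewrite -qp qs in ps.
Qed.

Lemma coeff_principal f p : pl f -> coeff p (principal f) = ord f p.
Proof.
move=> /pl_breakpoints[s [us s0 ss]]; exact: coeff_divisor_of s0 p.
Qed.

Lemma deg_principal f : pl f -> deg (principal f) = 0.
Proof.
move=> /pl_breakpoints[s [us s0 ss]].
rewrite [principal f](divisor_ofE us s0) raddf_sum /= -[RHS]ss.
by apply: eq_bigr => p _; rewrite degU.
Qed.

Implicit Types D E : divisor G.

Lemma divisorP D E : (forall p, coeff p D = coeff p E) -> D = E.
Proof. by move=> H; apply/eqP/freeg_eqP => p; exact: H. Qed.

Lemma deg_ge0 D : effective D -> 0 <= deg D.
Proof.
move=> effD; rewrite -(freeg_sumE D) raddf_sum /=.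
by apply: sumr_ge0 => p _; rewrite degU; exact: effD.
Qed.

Lemma deg_ge_coeff D p : effective D -> coeff p D <= deg D.
Proof.
move=> effD; rewrite -subr_ge0 -(degU (coeff p D) p) -degB; apply: deg_ge0 => q.
rewrite coeffB coeffU subr_ge0; case: eqP => [->|_]; first by rewrite mulr1.
by rewrite mulr0.
Qed.

Lemma lin_equivP D E : lin_equiv D E <->
  exists2 f, pl f & forall p, coeff p D = coeff p E + ord f p.
Proof.
split=> [[f [/rational_functionP plf DE]]|[f plf H]].
  exists f => // p; rewrite -(coeff_principal p plf) -DE coeffB; ring.
exists f; split; first exact/rational_functionP.
by apply: divisorP => p; rewrite coeffB coeff_principal // H; ring.
Qed.

Lemma lin_equiv_deg D E : lin_equiv D E -> deg D = deg E.
Proof.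
move=> [f [/rational_functionP plf DE]].
by apply/eqP; rewrite -subr_eq0 -degB DE deg_principal.
Qed.

Lemma lin_equiv_refl D : lin_equiv D D.
Proof.
apply/lin_equivP; exists (fun=> 0); first exact: pl_cst.
by move=> p; rewrite ord_cst addr0.
Qed.

Lemma lin_equiv_sym D E : lin_equiv D E -> lin_equiv E D.
Proof.
move=> /lin_equivP[f plf H]; apply/lin_equivP; exists (fun q => - f q); first exact: plN.
by move=> p; rewrite ordN // H; ring.
Qed.

Lemma lin_equiv_trans D E F : lin_equiv D E -> lin_equiv E F -> lin_equiv D F.
Proof.
move=> /lin_equivP[f plf Hf] /lin_equivP[g plg Hg]; apply/lin_equivP.
exists (fun q => f q + g q); first exact: plD.
by move=> p; rewrite ordD // Hf Hg; ring.
Qed.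

Lemma linsys_equiv D E : lin_equiv D E -> linsys D = linsys E.
Proof.
move=> DE; apply/seteqP; split=> F [effF FD]; split=> //.
  exact: lin_equiv_trans DE.
exact: lin_equiv_trans (lin_equiv_sym DE).
Qed.

End Rational.

(** * Slope estimates, convexity and supporting lines on an interval *)

Section RealGerms.
Variable R : realType.
Implicit Types (phi : R -> R) (a b t : R).

(** A mean value inequality from right slopes alone; continuity carries the bound through the limit
    step of the induction. *)
Lemma affine_upper phi a b (K : R) : a <= b ->
  (forall t, a <= t -> t < b -> exists2 m : R, m <= K &
    \forall h \near 0^'+, phi (t + h) = phi t + m * h) ->
  continuous phi ->
  phi b <= phi a + K * (b - a).
Proof.
move=> ab Hr cphi.
apply: (real_induction (P := fun t => phi t <= phi a + K * (t - a)) ab) => //.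
- by rewrite subrr mulr0 addr0.
- move=> t at_ tb Pt; have [m mK Hm] := Hr _ at_ tb.
  near=> h; have h0 : 0 < h by near: h; exact: near0_gt.
  have -> : phi (t + h) = phi t + m * h by near: h.
  have : m * h <= K * h by rewrite ler_pM2r.
  lra.
- move=> t at_ tb H; rewrite leNgt; apply/negP => Pt.
  pose u x := phi x - K * (x - a).
  have cu : {for t, continuous u}.
    apply: cvgB; first exact: cphi.
    by apply: cvgM; [exact: cvg_cst|apply: cvgB; [exact: cvg_id|exact: cvg_cst]].
  have /cvgrPdist_lt /(_ (u t - phi a)) := cu.
  have ut : 0 < u t - phi a by rewrite /u; lra.
  move=> /(_ ut) /nbhs_ballP [eps /= eps0 He].
  pose s := Num.max a (t - eps / 2).
  have st : s < t by rewrite gt_max at_; lra.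
  have as_ : a <= s by rewrite le_max lexx.
  have se : t - eps / 2 <= s by rewrite le_max lexx orbT.
  have /He : ball t eps s by rewrite /ball /= gtr0_norm; lra.
  have := H _ as_ st; rewrite /= ltr_norml /u => ? /andP[? ?]; lra.
Unshelve. all: by end_near. Qed.

Lemma affine_lower phi a b (K : R) : a <= b ->
  (forall t, a <= t -> t < b -> exists2 m : R, K <= m &
    \forall h \near 0^'+, phi (t + h) = phi t + m * h) ->
  continuous phi ->
  phi a + K * (b - a) <= phi b.
Proof.
move=> ab Hr cphi.
have := @affine_upper (fun x => - phi x) a b (- K) ab.
move=> /(_ _ _)/=; suff H : - phi b <= - phi a + - K * (b - a) -> phi a + K * (b - a) <= phi b.
  move=> /(_ _ _)/H; apply.
    move=> t at_ tb; have [m mK Hm] := Hr _ at_ tb; exists (- m); first by rewrite lerN2.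
    by move: Hm; apply: filterS => h ->; ring.
  by move=> x; apply: cvgN; exact: cphi.
lra.
Qed.

(* Nonnegative sums of outgoing slopes amount to convexity. *)
Lemma convex_support phi (eta : R) (rs ls : R -> int) : continuous phi ->
  (forall t, 0 <= t -> t < eta -> \forall h \near 0^'+,
     phi (t + h) = phi t + (rs t)%:~R * h /\ rs (t + h) = rs t) ->
  (forall t, 0 < t -> t < eta -> \forall h \near 0^'+, rs (t - h) = - ls t) ->
  (forall t, 0 < t -> t < eta -> 0 <= rs t + ls t) ->
  forall t0 t, 0 <= t0 -> t0 < eta -> 0 <= t -> t < eta ->
  phi t0 + (rs t0)%:~R * (t - t0) <= phi t.
Proof.
move=> cphi Hr Hl Hrl.
have mono t0 t : 0 <= t0 -> t0 <= t -> t < eta -> rs t0 <= rs t.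
  move=> t00 tt0 teta.
  apply: (real_induction (P := fun t => rs t0 <= rs t) tt0) => //.
    move=> s ts st Ps; have s0 : 0 <= s by lra.
    have seta : s < eta by lra.
    by apply: filterS (Hr _ s0 seta) => h [_ ->].
  move=> s ts st Ps; have s0 : 0 < s by lra.
  have seta : s < eta by lra.
  have /near0P[eps eps0 He] := Hl _ s0 seta.
  pose h := Num.min (eps / 2) (s - t0).
  have h0 : 0 < h by rewrite lt_min; apply/andP; split; lra.
  have h1 : h <= eps / 2 by rewrite ge_min lexx.
  have h2 : h <= s - t0 by rewrite ge_min lexx orbT.
  have he : h < eps by lra.
  have := Ps (s - h); rewrite He // => /(_ _ _) H.
  have /le_trans : rs t0 <= - ls s by apply: H; lra.
  by apply; rewrite -subr_ge0 opprK; exact: Hrl.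
move=> t0 t t00 t0eta tge teta; have [tt0|tt0] := leP t0 t.
  apply: affine_lower tt0 _ cphi => s ts st; exists (rs s)%:~R.
    by rewrite ler_int; apply: mono => //; lra.
  have s0 : 0 <= s by lra.
  have seta : s < eta by lra.
  by apply: filterS (Hr _ s0 seta) => h [].
have := @affine_upper phi t t0 (rs t0)%:~R (ltW tt0) _ cphi.
move=> /(_ _) H; have : phi t0 <= phi t + (rs t0)%:~R * (t0 - t).
  apply: H => s ts st; have s0 : 0 <= s by lra.
  have seta : s < eta by lra.
  exists (rs s)%:~R; first by rewrite ler_int; apply: mono => //; lra.
  by apply: filterS (Hr _ s0 seta) => h [].
lra.
Qed.

Definition supports phi (eta h0 : R) (m : int) :=
  forall h, 0 <= h -> h < eta -> phi h0 + m%:~R * (h - h0) <= phi h.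

(* A function with supporting lines of bounded integral slopes at every point *)
(* is affine near 0: a supporting slope at small points h > 0 that exceeds m  *)
(* would, as h tends to 0, be a supporting slope at 0.                        *)
Lemma supports_germ phi (eta : R) (K : nat) : 0 < eta ->
  (forall h, 0 <= h -> h < eta -> exists2 m : int, `|m| <= K%:Z & supports phi eta h m) ->
  exists2 m : int, \forall h \near 0^'+, phi h = phi 0 + m%:~R * h &
    forall n : int, `|n| <= K%:Z -> supports phi eta 0 n -> n <= m.
Proof.
move=> eta0 H.
(* Slopes between -K and K are shifted by K into the naturals, to get a largest supporting slope [m]
   at 0. *)
pose P (n : nat) := (n <= 2 * K)%N && `[< supports phi eta 0 (n%:Z - K%:Z) >].
have exP : exists n, P n.
  have [m mK Hm] := H 0 (lexx _) eta0; exists (absz (m + K%:Z)); apply/andP; split; first lia.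
  apply/asboolP; have -> : (absz (m + K%:Z))%:Z - K%:Z = m by lia.
  exact: Hm.
have ubP n : P n -> (n <= 2 * K)%N by case/andP.
case: (ex_maxnP exP ubP) => n0 /andP[n0K /asboolP Hn0] maxn.
pose m := n0%:Z - K%:Z; rewrite -/m in Hn0.
have maxm (n : int) : `|n| <= K%:Z -> supports phi eta 0 n -> n <= m.
  move=> nK Hn; have : P (absz (n + K%:Z)).
    apply/andP; split; first lia.
    by apply/asboolP; have -> : (absz (n + K%:Z))%:Z - K%:Z = n by lia.
  by move=> /maxn; rewrite /m; lia.
exists m => //.
have [[eps eps0 He]|nex] := pselect (exists2 eps : R, 0 < eps &
    forall h, 0 < h -> h < eps -> phi h <= phi 0 + m%:~R * h).
  apply/near0P; exists (Num.min eps eta); first by rewrite lt_min eps0.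
  move=> h h0; rewrite lt_min => /andP[he heta]; apply/eqP.
  rewrite eq_le He //=; have := Hn0 h (ltW h0) heta; rewrite subr0; exact.
(* If [phi] exceeds the line of slope [m] arbitrarily close to 0, then [m + 1] also supports [phi]
   at 0. *)
exfalso; suff : m + 1 <= m by lia.
have [h1 [h10 h1eta gap]] : exists h1, [/\ 0 < h1, h1 < eta & phi 0 + m%:~R * h1 < phi h1].
  apply: contrapT => N; apply: nex; exists eta => // h h0 heta.
  by rewrite leNgt; apply/negP => ?; apply: N; exists h.
have steep h : 0 < h -> h < eta -> phi 0 + m%:~R * h < phi h ->
    exists2 n : int, m + 1 <= n <= K%:Z & supports phi eta h n.
  move=> h0 heta gaph; have [n nK Hn] := H h (ltW h0) heta; exists n => //.
  apply/andP; split; last by lia.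
  have := Hn 0 (lexx _) eta0; rewrite sub0r => Hn'.
  suff : m < n by lia.
  by rewrite -(ltr_int R) -(ltr_pM2r h0); lra.
apply: maxm.
  have [n /andP[n1 n2] _] := steep _ h10 h1eta gap.
  by have : `|m| <= K%:Z by [rewrite /m; lia|]; rewrite /m; lia.
move=> h hge heta; rewrite subr0; move: hge; rewrite le_eqVlt => /orP[/eqP <-|h0].
  by rewrite mulr0 addr0.
rewrite leNgt; apply/negP => bad.
(* A line of slope at least m + 1 supporting [phi] at a point [k] with phi k > phi 0 + m k is, at
   [h], less than k below the line of slope m + 1 through 0. The bound on [k] makes this loss
   smaller than the supposed gap at [h]. *)
apply: nex; exists (Num.min h (phi 0 + (m + 1)%:~R * h - phi h)).
  by rewrite lt_min h0; lra.
move=> k k0; rewrite lt_min => /andP[kh kbad]; rewrite leNgt; apply/negP => gapk.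
have [|n /andP[n1 n2] Hn] := steep _ k0 _ gapk; first lra.
have := Hn h (ltW h0) heta.
have : (m + 1)%:~R * (h - k) <= n%:~R * (h - k) by rewrite ler_pM2r ?subr_gt0 // ler_int.
move: kbad gapk; rewrite !intrD; lra.
Qed.

(** If each index failed at some precision, the least of these finitely many precisions would have
    no index. It serves to fix slopes shared by functions that approximate a supremum arbitrarily
    well. *)
Lemma pigeonhole (T : finType) (P : T -> R -> Prop) :
  (forall i (e e' : R), e <= e' -> P i e -> P i e') ->
  (forall e : R, 0 < e -> exists i, P i e) -> exists i, forall e : R, 0 < e -> P i e.
Proof.
move=> mono H; apply: contrapT => N.
have {}N i : exists e : R, 0 < e /\ ~ P i e.
  apply: contrapT => Nt; apply: N; exists i => e e0; apply: contrapT => NP.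
  by apply: Nt; exists e.
have [e He] := choice N.
have e0 : 0 < \big[Num.min/1]_(i : T) e i.
  elim/big_ind : _ => // [x y x0 y0|i _]; first by rewrite lt_min x0.
  by case: (He i).
have [i Pi] := H _ e0; case: (He i) => _; apply; apply: mono Pi.
exact: bigmin_le_cond.
Qed.

End RealGerms.

(** * Bounds on the moves of a divisor, and existence of reduced divisors *)

Section Reduced.
Variables (R : realType) (G : metric_graph R).
Local Notation pt := (mg_point G).
Implicit Types (e : edge G) (p q w : pt) (d : edge G * bool) (f g : pt -> R).
Implicit Types D E : divisor G.

Definition stays_effective D f := forall p, 0 <= coeff p D + ord f p.

(* Summing the orders of max(f, f p) over the whole graph: the chips that     *)
(* leave p upwards have to be absorbed by D on the set where f > f p.         *)
Lemma slope_le_deg D f p d : effective D -> pl f -> stays_effective D f ->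
  d \in directions p -> slope f p d <= deg D.
Proof.
move=> effD plf eff dp.
pose c := f p; pose h q := Num.max (f q) c.
have plh : pl h by apply: pl_max => //; exact: pl_cst.
have slE q d' : d' \in directions q -> slope h q d' =
    if f q == c then Num.max (slope f q d') 0 else if f q < c then 0 else slope f q d'.
  by move=> dq; apply/slopeE/has_slope_max; [exact: plP|exact: has_slope_cst].
have ordh q : - coeff q D <= ord h q.
  rewrite /ord; case: (ltgtP (f q) c) => fq.
  - have -> : \sum_(d' in directions q) slope h q d' = 0.
      by apply: big1 => d' dq; rewrite slE // lt_eqF // fq.
    by rewrite oppr_le0; exact: effD.
  - rewrite (eq_bigr (slope f q)).
      by rewrite -subr_ge0 opprK addrC; exact: eff.
    by move=> d' dq; rewrite slE // gt_eqF // ltNge ltW.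
  - apply: (@le_trans _ _ 0); first by rewrite oppr_le0; exact: effD.
    by apply: sumr_ge0 => d' dq; rewrite slE // fq eqxx le_max lexx orbT.
have ordp : slope f p d <= ord h p.
  rewrite /ord (bigD1 d) //= slE // eqxx.
  apply: (@le_trans _ _ (Num.max (slope f p d) 0)); first by rewrite le_max lexx.
  rewrite lerDl; apply: sumr_ge0 => d' /andP[dq _].
  by rewrite slE // eqxx le_max lexx orbT.
have effE : effective (D + principal h).
  by move=> q; rewrite coeffD coeff_principal // -lerBlDl sub0r.
have := deg_ge_coeff p effE; rewrite coeffD coeff_principal // degD deg_principal // addr0.
by move: ordp (effD p); lra.
Qed.

(** The lower bound is the upper one applied, at a nearby point, to the direction looking back. *)
Lemma slope_bound D f p d : effective D -> pl f -> stays_effective D f ->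
  d \in directions p -> `|slope f p d| <= deg D.
Proof.
move=> effD plf eff dp; rewrite ler_norml (slope_le_deg effD plf eff dp) andbT lerNl.
have : \forall h \near (0 : R)^'+, - slope f p d <= deg D; last by move=> /near0_ex[].
have rv := slope_rev plf dp (plP plf dp).
near=> h; have [_ <-] : slope f (move p d h) d = slope f p d /\
   slope f (move p d h) (rev d) = - slope f p d by near: h.
have h0 : 0 < h by near: h; exact: near0_gt.
have ha : h < ahead p d by near: h; apply: near0_lt; exact: ahead_gt0.
by apply: (slope_le_deg effD plf eff); rewrite directions_move // !inE eqxx orbT.
Unshelve. all: by end_near. Qed.

Lemma directions_moveW p d h : d \in directions p -> 0 <= h -> h < ahead p d ->
  d \in directions (move p d h) /\ forall k, move (move p d h) d k = move p d (h + k).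
Proof.
move=> dp; rewrite le_eqVlt => /orP[/eqP <-|h0] ha.
  by rewrite move0 //; split => // k; rewrite add0r.
by split; [rewrite directions_move // !inE eqxx|move=> k; rewrite move_move].
Qed.

Lemma pl_move_continuous f p d : pl f -> continuous (f \o move p d).
Proof.
move=> /pl_continuous cf h; apply: continuous_comp; first exact: move_continuous.
exact: cf.
Qed.

Lemma lipschitz_move D f p d h : effective D -> pl f -> stays_effective D f ->
  d \in directions p -> 0 <= h -> h <= ahead p d ->
  `|f (move p d h) - f p| <= (deg D)%:~R * h.
Proof.
move=> effD plf eff dp h0 ha.
have Hr t : 0 <= t -> t < h -> exists m : int, `|m| <= deg D /\
    \forall x \near 0^'+, (f \o move p d) (t + x) = (f \o move p d) t + m%:~R * x.
  move=> t0 th; have [dt mE] := directions_moveW dp t0 (lt_le_trans th ha).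
  exists (slope f (move p d t) d); split; first exact: slope_bound effD plf eff dt.
  by have := plP plf dt; apply: filterS => x /=; rewrite mE.
have u : f (move p d h) <= f p + (deg D)%:~R * h.
  have /= := @affine_upper _ _ 0 h (deg D)%:~R h0 _ (pl_move_continuous (p:=p) (d:=d) plf).
  rewrite move0 // subr0; apply.
  move=> t t0 th; have [m [mD Hm]] := Hr _ t0 th; exists m%:~R => //.
  by rewrite ler_int; apply: le_trans mD; exact: ler_norm.
have l : f p + - (deg D)%:~R * h <= f (move p d h).
  have /= := @affine_lower _ _ 0 h (- (deg D)%:~R) h0 _ (pl_move_continuous (p:=p) (d:=d) plf).
  rewrite move0 // subr0; apply.
  move=> t t0 th; have [m [mD Hm]] := Hr _ t0 th; exists m%:~R => //.
  by rewrite -intrN ler_int lerNl; apply: le_trans mD; rewrite -normrN; exact: ler_norm.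
by rewrite ler_norml; apply/andP; split; lra.
Qed.

Lemma lipschitz_edge D f e (t : R) : effective D -> pl f -> stays_effective D f ->
  0 <= t -> t <= len e ->
  `|f (edge_pt e t) - f (inl (src e))| <= (deg D)%:~R * len e.
Proof.
move=> effD plf eff t0 tl; have [dp mE] := @edge_forward _ G e 0 (lexx _) (len_gt0 e).
rewrite edge_pt_le0 // in dp mE.
have ah : ahead (inl (src e) : pt) (e, true) = len e by rewrite /ahead /= subr0.
have := lipschitz_move effD plf eff dp t0; rewrite ah mE add0r => /(_ tl) /le_trans; apply.
by apply: ler_wpM2l => //; rewrite ler0z; exact: deg_ge0.
Qed.

(** Slopes are at most deg D in absolute value, so a bound at one point of an edge spreads to the
    whole edge, and connectedness of the graph carries it from [w] to every point. *)
Lemma bounded_values D w : effective D -> exists C : pt -> R,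
  forall f q, pl f -> stays_effective D f -> f w = 0 -> `|f q| <= C q.
Proof.
move=> effD.
pose bnd q := exists C : R, forall f, pl f -> stays_effective D f -> f w = 0 -> `|f q| <= C.
suff H q : bnd q.
  by have [C HC] := choice H; exists C => f q; exact: HC.
have bnd_edge e t t' : 0 <= t -> t <= len e -> 0 <= t' -> t' <= len e ->
    bnd (edge_pt e t) -> bnd (edge_pt e t').
  move=> t0 tl t0' tl' [C HC]; exists (C + ((deg D)%:~R * len e + (deg D)%:~R * len e)) => f plf eff fw.
  have := lipschitz_edge effD plf eff t0 tl.
  have := lipschitz_edge effD plf eff t0' tl'.
  have := HC f plf eff fw.
  rewrite !ler_norml => /andP[? ?] /andP[? ?] /andP[? ?].
  by apply/andP; split; lra.
have bw : bnd w by exists 0 => f _ _ ->; rewrite normr0.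
have [x bx] : exists x : vertex G, bnd (inl x).
  move: (w) bw => [x bx|[[e t] etP] bw]; first by exists x.
  have /andP[/= t0 tl] := etP.
  exists (src e); rewrite -(edge_pt_le0 e (lexx 0)); apply: (bnd_edge e t) => //; try exact: ltW.
    exact/ltW/len_gt0.
  by rewrite (edge_pt_in etP).
have bv y : bnd (inl y).
  have /connectP[s ps ->] := graph_connected x y.
  elim: s x bx ps => //= z s IH x bx /andP[/existsP[e He] ps]; apply: (IH z) => //.
  have l0 := ltW (len_gt0 e).
  case/orP: He => /andP[/eqP E1 /eqP E2].
    rewrite -E2 -(edge_pt_ge (lexx (len e))); apply: (bnd_edge e 0) => //.
    by rewrite edge_pt_le0 // E1.
  rewrite -E1 -(edge_pt_le0 e (lexx _)); apply: (bnd_edge e (len e)) => //.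
  by rewrite edge_pt_ge // E2.
case: q => [y|[[e t] etP]]; first exact: bv.
have /andP[/= t0 tl] := etP; rewrite -(edge_pt_in etP).
apply: (bnd_edge e 0) => //; try exact: ltW; first exact/ltW/len_gt0.
by rewrite edge_pt_le0 //; exact: bv.
Qed.

Lemma near_notin p d (s : seq pt) : d \in directions p ->
  \forall h \near 0^'+, move p d h \notin s.
Proof.
move=> dp; elim: s => [|q s IH]; first by apply: nearW.
apply: filterS2 IH (near_neq q dp) => h hs hq.
by rewrite inE negb_or hs andbT; apply/eqP.
Qed.

Lemma rev_neq d : d != rev d.
Proof. by case: d => e []; rewrite /rev xpair_eqE eqxx. Qed.

Lemma ord_move f p d h : d \in directions p -> 0 < h -> h < ahead p d ->
  ord f (move p d h) = slope f (move p d h) d + slope f (move p d h) (rev d).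
Proof.
by move=> dp h0 ha; rewrite /ord directions_move // big_setU1 ?big_set1 // inE rev_neq.
Qed.

(** Where [D] has no chip, effectiveness of D + (f) says that the outgoing slopes of [f] have
    nonnegative sum, so that [f] is convex along the edge. *)
Lemma supporting_slope D f p d (eta : R) : pl f -> stays_effective D f ->
  d \in directions p -> eta <= ahead p d ->
  (forall h, 0 < h -> h < eta -> coeff (move p d h) D = 0) ->
  forall h, 0 <= h -> h < eta ->
  supports (f \o move p d) eta h (slope f (move p d h) d).
Proof.
move=> plf eff dp eta_a D0 h h0 heta k k0 keta.
apply: (convex_support (phi := f \o move p d) (eta := eta)
  (rs := fun t => slope f (move p d t) d)
  (ls := fun t => slope f (move p d t) (rev d)) (pl_move_continuous (p:=p) (d:=d) plf)) => //.
- move=> t t0 teta; have [dt mE] := directions_moveW dp t0 (lt_le_trans teta eta_a).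
  have := slope_rev plf dt (plP plf dt); have := plP plf dt.
  by apply: filterS2 => x /= + [+ _]; rewrite !mE.
- move=> t t0 teta; have ta := lt_le_trans teta eta_a.
  have dt : rev d \in directions (move p d t) by rewrite directions_move // !inE eqxx orbT.
  have := slope_rev plf dt (plP plf dt).
  apply: filterS => x [_]; rewrite move_rev // => E.
  by rewrite -E /rev /= negbK -surjective_pairing.
- move=> t t0 teta; have ta := lt_le_trans teta eta_a.
  by have := eff (move p d t); rewrite D0 // add0r ord_move.
Qed.

Definition reduced w D := effective D /\
  forall g, pl g -> stays_effective D g -> forall q, g q <= g w.

Lemma exists_reduced w D : effective D ->
  exists E, [/\ effective E, lin_equiv E D & reduced w E].
Proof.
move=> effD; have [C HC] := bounded_values w effD.
pose RD := [set f | [/\ pl f, stays_effective D f & f w = 0]].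
pose F q := sup [set f q | f in RD].
have hs q : has_sup [set f q | f in RD].
  split.
    exists 0; exists (fun=> 0) => //; split => //; first exact: pl_cst.
    by move=> p; rewrite ord_cst addr0; exact: effD.
  by exists (C q) => _ [f [plf eff fw] <-]; apply: le_trans (HC f q plf eff fw); exact: ler_norm.
have leF f q : RD f -> f q <= F q.
  by move=> Rf; apply: ub_le_sup; [case: (hs q)|exists f].
have Fw : F w = 0.
  rewrite /F (_ : [set f w | f in RD] = [set 0]) ?sup1 //.
  apply/seteqP; split=> [_ [f [_ _ fw] <-] //|_ ->].
  exists (fun=> 0) => //; split => //; first exact: pl_cst.
  by move=> p; rewrite ord_cst addr0; exact: effD.
have adh q (eps : R) : 0 < eps -> exists2 f, RD f & F q - eps < f q.
  by move=> eps0; have [_ [f Rf <-] H] := sup_adherent eps0 (hs q); exists f.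
pose K := absz (deg D); have KE : K%:Z = deg D by rewrite /K gez0_abs // deg_ge0.
(* The possible slopes, indexed by a finite type for [pigeonhole]. *)
pose val (i : 'I_(2 * K).+1) : int := (i : nat)%:Z - K%:Z.
have valP f p d : RD f -> d \in directions p -> exists i, val i = slope f p d.
  move=> [plf eff _] dp; have := slope_bound effD plf eff dp; rewrite -KE => sK.
  exists (inord (absz (slope f p d + K%:Z))); rewrite /val inordK; lia.
have valK i : `|val i| <= K%:Z by rewrite /val; have := ltn_ord i; lia.
have local p : exists2 eta : R, 0 < eta & forall d, d \in directions p ->
    eta <= ahead p d /\ forall h, 0 < h -> h < eta -> coeff (move p d h) D = 0.
  have [eta eta0 He] : exists2 eta : R, 0 < eta &
     forall d h, d \in directions p -> 0 < h -> h < eta ->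
       h < ahead p d /\ move p d h \notin dom D.
    apply: near0_dirs => d dp.
    have := near_notin (dom D) dp; have := near0_lt (ahead_gt0 dp).
    by apply: filterS2.
  exists eta => // d dp; split.
    rewrite leNgt; apply/negP => lt.
    by have [] := He d (ahead p d) dp (ahead_gt0 dp) lt; rewrite ltxx.
  by move=> h h0 heta; apply: coeff_outdom; case: (He d h dp h0 heta).
(* Supporting lines pass to the supremum: functions of [RD] arbitrarily close to [F] at [move p d h]
   share a slope there, and in the limit this slope supports [F]. *)
have supp p d (eta : R) : d \in directions p -> eta <= ahead p d ->
    (forall h, 0 < h -> h < eta -> coeff (move p d h) D = 0) ->
    forall h, 0 <= h -> h < eta ->
    exists2 m : int, `|m| <= K%:Z & supports (F \o move p d) eta h m.
  move=> dp eta_a D0 h h0 heta.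
  have [dh _] := directions_moveW dp h0 (lt_le_trans heta eta_a).
  have [//||i Hi] := @pigeonhole _ _ (fun i (eps : R) => exists2 f, RD f /\
      slope f (move p d h) d = val i & F (move p d h) - eps < f (move p d h)).
  - move=> i e e' ee [f Rf lt]; exists f => //; apply: le_lt_trans lt.
    by rewrite lerD2l lerN2.
  - move=> eps eps0; have [f Rf lt] := adh (move p d h) _ eps0.
    by have [i Ei] := valP _ _ _ Rf dh; exists i, f.
  exists (val i) => // k k0 keta; rewrite leNgt; apply/negP => gap.
  pose eps := F (move p d h) + (val i)%:~R * (k - h) - F (move p d k).
  have eps0 : 0 < eps by rewrite subr_gt0.
  have [f [Rf sE] lt] := Hi _ eps0; have [plf eff _] := Rf.
  have := supporting_slope plf eff dp eta_a D0 h0 heta k0 keta; rewrite sE /=.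
  by have := leF f (move p d k) Rf; move: lt; rewrite /eps; lra.
have germ p d : d \in directions p -> exists2 m, has_slope F p d m &
   forall n : int, `|n| <= K%:Z -> (exists2 eta : R, 0 < eta & 
     supports (F \o move p d) eta 0 n) -> n <= m.
  move=> dp; have [eta eta0 /(_ _ dp)[eta_a D0]] := local p.
  have [m Hm maxm] := supports_germ eta0 (supp p d eta dp eta_a D0).
  have Hm' : has_slope F p d m by move: Hm; apply: filterS => h /=; rewrite move0.
  exists m => // n nK [eta' eta'0 Hn].
  rewrite leNgt; apply/negP => mn.
  have : \forall h \near (0:R)^'+, False; last by move=> /near0_ex[].
  near=> h.
  have h0 : 0 < h by near: h; exact: near0_gt.
  have heta : h < eta' by near: h; exact: near0_lt.
  have E : F (move p d h) = F p + m%:~R * h by near: h; exact: Hm'.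
  have := Hn h (ltW h0) heta; rewrite /= move0 // subr0 E lerD2l ler_pM2r // ler_int.
  by rewrite leNgt mn.
have plF : pl F by move=> p d dp; have [m Hm _] := germ p d dp; exists m.
(* All directions at [p] are treated together: one family of slopes is shared by functions
   approximating [F] at [p]. Each of them supports [F], so it is at most the slope of [F], and
   [ord F p] is at least the order of one such function. *)
have effF : stays_effective D F.
  move=> p.
  have [//||i Hi] := @pigeonhole _ {ffun edge G * bool -> 'I_(2 * K).+1}
    (fun i (eps : R) => exists2 f, RD f /\
      (forall d, d \in directions p -> slope f p d = val (i d)) & F p - eps < f p).
  - move=> i e e' ee [f Rf lt]; exists f => //; apply: le_lt_trans lt.
    by rewrite lerD2l lerN2.
  - move=> eps eps0; have [f Rf lt] := adh p _ eps0.
    have [|i Hi] := @choice _ _ (fun d i => d \in directions p -> slope f p d = val i).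
      move=> d; have [dp|_] := boolP (d \in directions p); last by exists ord0.
      by have [i Ei] := valP _ _ _ Rf dp; exists i.
    by exists [ffun d => i d], f => //; split => // d dp; rewrite ffunE Hi.
  have [f [[plf eff _] sE] _] := Hi 1 ltr01.
  apply: le_trans (eff p) _; rewrite lerD2l; apply: ler_sum => d dp.
  have [m Hm maxm] := germ p d dp; rewrite (slopeE Hm) sE //; apply: maxm => //.
  have [eta eta0 /(_ _ dp)[eta_a D0]] := local p; exists eta => //.
  move=> k k0 keta; rewrite /= move0 // subr0 leNgt; apply/negP => gap.
  pose eps := F p + (val (i d))%:~R * k - F (move p d k).
  have eps0 : 0 < eps by rewrite subr_gt0.
  have [g [[plg effg gw] sE'] lt] := Hi _ eps0.
  have := supporting_slope plg effg dp eta_a D0 (lexx _) eta0 k0 keta.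
  rewrite /= move0 // sE' // subr0.
  have Rg : RD g by split.
  by have := leF g (move p d k) Rg; move: lt; rewrite /eps; lra.
have cE q : coeff q (D + principal F) = coeff q D + ord F q.
  by rewrite coeffD coeff_principal.
have effE : effective (D + principal F) by move=> q; rewrite cE; exact: effF.
exists (D + principal F); split => //.
  by apply/lin_equivP; exists F.
split=> // g plg effg q.
(* The function F + g - g(w) competes in the supremum, hence is at most [F]. *)
have /(leF _ q) : RD (fun x => F x + (g x + - g w)).
  split; [|move=> p|by rewrite Fw subrr addr0].
    by apply: plD => //; apply: plD => //; exact: pl_cst.
  rewrite ordD //; last by apply: plD => //; exact: pl_cst.
  rewrite ordD //; last exact: pl_cst.
  by rewrite ord_cst addr0 addrA -cE; exact: effg.
by rewrite /= gerDl subr_le0.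
Unshelve. all: by end_near. Qed.

End Reduced.

(** * Outdegree in terms of directions *)

Section Segments.
Variables (R : realType) (G : metric_graph R).
Local Notation pt := (mg_point G).
Implicit Types (e : edge G) (p q v : pt) (d : edge G * bool).
Implicit Types (S X U W A : set pt).

Lemma near_component A p d : A p -> d \in directions p ->
  (\forall h \near 0^'+, A (move p d h)) ->
  \forall h \near 0^'+, connected_component A p (move p d h).
Proof.
move=> Ap dp /near0P[eps eps0 H]; apply/near0P; exists eps => // h h0 he.
pose Z := move p d @` `[0, h].
have cZ : connected Z by apply: segment_connected; exact: interval_is_interval.
have Zh : Z (move p d h) by exists h => //=; rewrite in_itv /= lexx ltW.
have Zp : Z p by exists 0; rewrite ?move0 //= in_itv /= lexx ltW.
apply: (subset_component (Z := Z) (q := p)) => //.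
  move=> q [k /= + kq]; rewrite in_itv /= le_eqVlt -kq => /andP[/orP[/eqP <-|k0] kh].
    by rewrite move0.
  by apply: H => //; apply: le_lt_trans he.
exact: connected_component_refl.
Qed.

(** At a vertex this rests on the absence of loops: an edge leaves it in one direction only. *)
Lemma move_dir_inj p d d' (h k : R) : d \in directions p -> d' \in directions p ->
  0 < h -> h < ahead p d -> 0 < k -> move p d h = move p d' k -> d = d'.
Proof.
move=> dp dp' h0 ha k0 E; have [ee E'] := move_inj dp h0 ha dp' E.
suff bb : d.2 = d'.2 by rewrite (surjective_pairing d) ee bb -surjective_pairing.
clear E ha; move: p dp dp' E' => [x|x]; rewrite !inE /start /shift /= -ee.
  have := src_neq_tgt d.1.
  by case: d.2; case: d'.2 => // ne /eqP E1 /eqP E2; rewrite E1 E2 eqxx in ne.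
by case: d.2; case: d'.2 => // _ _; lra.
Qed.

Lemma segment_dir v S : segment_at v S ->
  exists2 d, d \in directions v & \forall h \near 0^'+, S (move v d h).
Proof.
move=> [e [a [b [a0 ab bl -> [->|->]]]]].
  have [dp mE] := @edge_forward _ G e a a0 (lt_le_trans ab bl).
  exists (e, true) => //; apply/near0P; exists (b - a); first by rewrite subr_gt0.
  move=> h h0 hb; rewrite mE; exists (a + h) => //=.
  by rewrite in_itv /=; apply/andP; split; lra.
have [dp mE] := @edge_backward _ G e b (le_lt_trans a0 ab) bl.
exists (e, false) => //; apply/near0P; exists (b - a); first by rewrite subr_gt0.
move=> h h0 hb; rewrite mE; exists (b - h) => //=.
by rewrite in_itv /=; apply/andP; split; lra.
Qed.

Lemma segment_dir_ex v S : segment_at v S ->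
  exists d, d \in directions v /\ \forall h \near 0^'+, S (move v d h).
Proof. by move=> /segment_dir[d]; exists d. Qed.

Lemma dir_segment v d (eps : R) : d \in directions v -> 0 < eps -> eps <= ahead v d ->
  exists2 S, segment_at v S & forall q, S q -> exists h, [/\ 0 < h, h < eps & q = move v d h].
Proof.
move=> dv eps0 ea; have /andP[s0 sl] := start_bounds dv.
have vE := startP dv; move: ea; rewrite /ahead.
case bE: d.2 => ea.
  exists (edge_pt d.1 @` `]start v d, start v d + eps[).
    exists d.1, (start v d), (start v d + eps); split; [done|lra|lra|done|by left].
  move=> q [t /= + tq]; rewrite in_itv /= -tq => /andP[t1 t2].
  by exists (t - start v d); split; [lra|lra|rewrite moveE bE /=; congr edge_pt; ring].
exists (edge_pt d.1 @` `]start v d - eps, start v d[).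
  exists d.1, (start v d - eps), (start v d); split; [lra|lra|done|done|by right].
move=> q [t /= + tq]; rewrite in_itv /= -tq => /andP[t1 t2].
by exists (start v d - t); split; [lra|lra|rewrite moveE bE /=; congr edge_pt; ring].
Qed.

(** Disjoint segments ending at [v] start along different directions. Hence the maximum in [outdeg]
    exists. *)
Lemma out_segments_bound X v n : has_out_segments X v n -> (n <= #|{: edge G * bool}|)%N.
Proof.
move=> [S [HS tS]].
have [d Hd] := choice (fun i => segment_dir_ex (proj1 (HS i))).
rewrite -[n]card_ord; apply: (leq_card d) => i j dij.
have [_ Hi] := Hd i; have [_ Hj] := Hd j; rewrite -dij in Hj.
apply: contrapT => ij.
apply: (near0_absurd Hi); apply: filterS Hj => h Sj Si.
by apply: ij; apply: tS => //; exists (move v (d i) h).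
Qed.

Lemma outdegP X v : has_out_segments X v (outdeg X v) /\
  forall m, has_out_segments X v m -> (m <= outdeg X v)%N.
Proof.
have ex0 : exists n, `[< has_out_segments X v n >].
  by exists 0; apply/asboolP; exists (fun=> set0); split=> [[]//|]; exact: trivIset_set0.
have ub n : `[< has_out_segments X v n >] -> (n <= #|{: edge G * bool}|)%N.
  by move=> /asboolP; exact: out_segments_bound.
have ex : exists n, [set n | has_out_segments X v n /\
                    forall m, has_out_segments X v m -> (m <= n)%N] n.
  case: (ex_maxnP ex0 ub) => n /asboolP Hn maxn; exists n; split => // m Hm.
  by apply: maxn; apply/asboolP.
exact: (xgetPex 0%N ex).
Qed.

Lemma outdeg_ge2P X v : (2 <= outdeg X v)%N <->
  exists d d', [/\ d != d', d \in directions v, d' \in directions v,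
    \forall h \near 0^'+, ~ X (move v d h) & \forall h \near 0^'+, ~ X (move v d' h)].
Proof.
split=> [|[d1 [d2 [ne d1v d2v H1 H2]]]].
  have [[S [HS tS]] _] := outdegP X v; move=> out2.
  pose i := Ordinal (ltnW out2); pose j := Ordinal out2.
  have [sS1 sX1] := HS i; have [sS2 sX2] := HS j.
  have [d1 d1v H1] := segment_dir sS1; have [d2 d2v H2] := segment_dir sS2.
  exists d1, d2; split => //.
  - apply/eqP => dd; apply: (near0_absurd H1); rewrite dd.
    apply: filterS H2 => h Sj Si; have : i = j by apply: tS => //; exists (move v d2 h).
    by move=> /(congr1 val).
  - by apply: filterS H1 => h /sX1.
  - by apply: filterS H2 => h /sX2.
have [_] := outdegP X v; apply.
have good d : d \in directions v -> (\forall h \near 0^'+, ~ X (move v d h)) ->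
    exists S, [/\ segment_at v S, S `<=` ~` X & forall q, S q -> exists h,
      [/\ 0 < h, h < ahead v d & q = move v d h]].
  move=> dv /near0P[eps eps0 He].
  have [||S sS SP] := @dir_segment v d (Num.min eps (ahead v d)) dv.
  - by rewrite lt_min eps0 ahead_gt0.
  - by rewrite ge_min lexx orbT.
  exists S; split => //.
    by move=> q /SP[h [h0]]; rewrite lt_min => /andP[he _] ->; exact: He.
  by move=> q /SP[h [h0]]; rewrite lt_min => /andP[_ ha] ->; exists h.
have [S1 [sS1 SX1 P1]] := good _ d1v H1; have [S2 [sS2 SX2 P2]] := good _ d2v H2.
exists (fun i : 'I_2 => if i == 0 :> nat then S1 else S2); split.
  by move=> i; case: ifP.
have disj q : S1 q -> S2 q -> False.
  move=> /P1[h [h0 ha ->]] /P2[k [k0 ka E]].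
  by move: ne; rewrite (move_dir_inj d1v d2v h0 ha k0 E) eqxx.
move=> i j _ _ [q []].
case: ifPn => [/eqP i0|i0]; case: ifPn => [/eqP j0|j0].
- by move=> _ _; apply: val_inj; rewrite /= i0 j0.
- by move=> a b; have := disj _ a b.
- by move=> a b; have := disj _ b a.
- move=> _ _; apply: val_inj => /=.
  by move: i j i0 j0 => [[|[|]]//= ?] [[|[|]]//=].
Qed.

End Segments.

(** * Firing a closed set: the function -min(eps, dist(., X)) *)

Section Bump.
Variable R : realType.
Implicit Types (u v : R -> R) (t s x : R).

Definition convex_germ u t := exists m n : int,
  [/\ \forall h \near 0^'+, u (t + h) = u t + m%:~R * h,
      \forall h \near 0^'+, u (t - h) = u t + n%:~R * h & 0 <= m + n].

Lemma convex_germ_cst (c : R) t : convex_germ (fun=> c) t.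
Proof. by exists 0, 0; split=> //; apply: nearW => h; rewrite mul0r addr0. Qed.

Lemma convex_germ_dist s t : s != t -> convex_germ (fun x => - `|x - s|) t.
Proof.
rewrite neq_lt => /orP[st|ts].
  exists (-1), 1; split => //.
    near=> h; have h0 : 0 < h by near: h; exact: near0_gt.
    by rewrite !gtr0_norm; [ring|lra|lra].
  near=> h; have h0 : h < t - s by near: h; apply: near0_lt; lra.
  by rewrite !gtr0_norm; [ring|lra|lra].
exists 1, (-1); split => //.
  near=> h; have h0 : h < s - t by near: h; apply: near0_lt; lra.
  by rewrite !ltr0_norm; [ring|lra|lra].
near=> h; have h0 : 0 < h by near: h; exact: near0_gt.
by rewrite !ltr0_norm; [ring|lra|lra].
Unshelve. all: by end_near. Qed.

Lemma convex_germ_max u v t : convex_germ u t -> convex_germ v t ->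
  convex_germ (fun x => Num.max (u x) (v x)) t.
Proof.
move=> [m [n [Hm Hn mn]]] [m' [n' [Hm' Hn' mn']]].
do 2 eexists; split; [exact: affine_germ_max Hm Hm'|exact: affine_germ_max Hn Hn'|].
case: eqP => _; last by case: ifP.
apply: le_trans mn _; apply: lerD; by rewrite le_max lexx.
Qed.

(** This is -min(eps, dist(t, B)), written as a maximum of functions that are affine off [B], so
    that convexity off [B] is immediate. *)
Definition hat (eps : R) (B : seq R) t := \big[Num.max/- eps]_(s <- B) - `|t - s|.

Lemma convex_germ_hat (eps : R) B t : t \notin B -> convex_germ (hat eps B) t.
Proof.
elim: B => [|s B IH].
  move=> _; rewrite (_ : hat _ _ = fun=> - eps); first exact: convex_germ_cst.
  by apply/funext => x; rewrite /hat big_nil.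
rewrite inE negb_or => /andP[ts tB].
rewrite (_ : hat _ _ = fun x => Num.max (- `|x - s|) (hat eps B x)); last first.
  by apply/funext => x; rewrite /hat big_cons.
by apply: convex_germ_max; [apply: convex_germ_dist; rewrite eq_sym|exact: IH].
Qed.

Lemma hat_le eps B t (c : R) : - eps <= c -> (forall s, s \in B -> - `|t - s| <= c) ->
  hat eps B t <= c.
Proof.
move=> ec H; rewrite /hat big_seq; elim/big_ind : _ => // x y xc yc.
by rewrite ge_max xc.
Qed.

Lemma hat_lt0 eps B t : 0 < eps -> t \notin B -> hat eps B t < 0.
Proof.
move=> e0 tB; rewrite /hat big_seq; elim/big_ind : _ => [|x y x0 y0|s sB].
- lra.
- by rewrite gt_max x0.
- by rewrite oppr_lt0 normr_gt0 subr_eq0; apply: contraNneq tB => ->.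
Qed.

Lemma hat_ge eps B t s : s \in B -> - `|t - s| <= hat eps B t.
Proof.
by rewrite /hat; elim: B => // s' B IH; rewrite inE big_cons le_max => /orP[/eqP ->|/IH ->];
  rewrite ?lexx ?orbT.
Qed.

Lemma hat_geN eps B t : - eps <= hat eps B t.
Proof. by rewrite /hat; elim: B => [|s B IH]; rewrite ?big_nil // big_cons le_max IH orbT. Qed.

Lemma seq_pos_lbound (l : seq R) : exists2 eps : R, 0 < eps &
  forall x, x \in l -> 0 < x -> eps <= x.
Proof.
elim: l => [|x l [eps e0 H]]; first by exists 1.
have [x0|x0] := ltP 0 x.
  exists (Num.min eps x); first by rewrite lt_min e0.
  move=> y; rewrite inE => /orP[/eqP ->|/H yl] y0; rewrite ge_min; first by rewrite lexx orbT.
  by rewrite yl.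
exists eps => // y; rewrite inE => /orP[/eqP ->|/H //]; by rewrite ltNge x0.
Qed.

Variable G : metric_graph R.
Local Notation pt := (mg_point G).
Implicit Types (e : edge G) (p q : pt) (d : edge G * bool) (X : set pt).

Definition leaving X p : {set edge G * bool} :=
  [set d in directions p | `[< \forall h \near 0^'+, ~ X (move p d h) >]]%SET.

Lemma bump_exists (E : divisor G) X : effective E ->
  (forall p d, ~ X p -> d \in directions p -> \forall h \near 0^'+, ~ X (move p d h)) ->
  (forall p d, X p -> d \in directions p -> d \notin leaving X p ->
     \forall h \near 0^'+, X (move p d h)) ->
  (forall p, X p -> #|leaving X p|%:Z <= coeff p E) ->
  exists g, [/\ pl g, stays_effective E g, forall p, X p -> g p = 0 &
    forall p, ~ X p -> g p < 0].
Proof.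
move=> effE clX dichX leX.
pose coord e p : option R := if p is inr x then
  (if (val x).1 == e then Some (val x).2 else None) else None.
(* Contains every point of [e] where [X] is left along [e]: an inner one has a leaving direction,
   hence a chip of [E], and so occurs in [dom E]. *)
pose B e := [seq s <- 0 :: len e :: pmap (coord e) (dom E) | `[< X (edge_pt e s) >]].
have BX e s : s \in B e -> X (edge_pt e s) by rewrite mem_filter => /andP[/asboolP].
(* With the factor 2, points within eps of a vertex outside [X] are at distance at least eps from
   [B], so the bump is constantly -eps around that vertex. *)
have [eps eps0 Heps] : exists2 eps : R, 0 < eps & forall e s, s \in B e ->
    (0 < s -> 2 * eps <= s) /\ (0 < len e - s -> 2 * eps <= len e - s).
  have [eps eps0 He] := seq_pos_lbound
    (flatten [seq [seq s / 2 | s <- B e] ++ [seq (len e - s) / 2 | s <- B e] | e <- enum (edge G)]).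
  exists eps => // e s sB; split => s0.
    suff : eps <= s / 2 by lra.
    apply: He; last lra.
    apply/flattenP; eexists; first by apply: (map_f _ (x := e)); rewrite mem_enum.
    by rewrite mem_cat (map_f (fun s : R => s / 2)).
  suff : eps <= (len e - s) / 2 by lra.
  apply: He; last lra.
  apply/flattenP; eexists; first by apply: (map_f _ (x := e)); rewrite mem_enum.
  by rewrite mem_cat (map_f (fun s : R => (len e - s) / 2)) ?orbT.
pose g q := if `[< X q >] then 0 else if q is inr x then
  hat eps (B (val x).1) (val x).2 else - eps.
have gX p : X p -> g p = 0 by move=> Xp; rewrite /g asboolT.
have gE e t : 0 < t -> t < len e -> ~ X (edge_pt e t) -> g (edge_pt e t) = hat eps (B e) t.
  by move=> t0 tl nX; rewrite /g asboolF // (edge_pt_in (introT andP (conj t0 tl))).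
have gmove p d : d \in directions p -> (\forall h \near 0^'+, ~ X (move p d h)) ->
    \forall h \near 0^'+, g (move p d h) = hat eps (B d.1) (shift d.2 (start p d) h).
  move=> dp; have := near0_lt (ahead_gt0 dp); have := @near0_gt R.
  apply: filterS3 => h h0 ha; have /andP[a b] := shift_in dp h0 ha.
  by rewrite moveE; exact: gE.
have startB p d : X p -> d \in leaving X p -> start p d \in B d.1.
  move=> Xp /[dup] dl; rewrite inE => /andP[dp _].
  rewrite mem_filter startP // asboolT //=.
  case: p Xp dl dp => [x|x] Xp dl dp /=.
    by rewrite !inE; case: d.2; rewrite eqxx ?orbT.
  rewrite !inE mem_pmap; apply/orP; right; apply/orP; right.
  apply/mapP; exists (inr x).
    rewrite mem_dom -normr_gt0; apply: lt_le_trans (ler_norm _).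
    apply: lt_le_trans (leX _ Xp); rewrite ltz_nat; apply/card_gt0P; by exists d.
  by move: dp; rewrite inE => /eqP ->; rewrite /= eqxx.
have slX p d : X p -> d \in directions p ->
    has_slope g p d (if d \in leaving X p then -1 else 0).
  move=> Xp dp; case: ifPn => dl; last first.
    have := dichX _ _ Xp dp dl; apply: filterS => h Xh.
    by rewrite !gX // mul0r addr0.
  have sB := startB _ _ Xp dl.
  have /asboolP nX : `[< \forall h \near 0^'+, ~ X (move p d h) >].
    by move: dl; rewrite inE => /andP[].
  have gm := gmove _ _ dp nX; move/near0P : nX => [eta eta0 nX].
  near=> h.
  have h0 : 0 < h by near: h; exact: near0_gt.
  have he : h < eps by near: h; exact: near0_lt.
  (* A point of [B] closer than [h] to the moved point would be within 2h < eta of [p] in direction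
     [d], where [X] is absent. *)
  have heta : h < eta / 2 by near: h; apply: near0_lt; lra.
  have -> : g (move p d h) = hat eps (B d.1) (shift d.2 (start p d) h) by near: h.
  rewrite gX // add0r mulN1r; apply/eqP; rewrite eq_le; apply/andP; split.
    apply: hat_le => [|s sBs]; first lra.
    have out : forall k, 0 < k -> k < eta -> s <> shift d.2 (start p d) k.
      move=> k k0 keta sE; apply: (nX k k0 keta); rewrite moveE -sE; exact: BX.
    rewrite lerN2 leNgt; apply/negP; rewrite ltr_norml => /andP[].
    move: out; rewrite /shift; case: d.2 => out b1 b2.
      by apply: (out (s - start p d)); lra.
    by apply: (out (start p d - s)); lra.
  have := hat_ge eps (shift d.2 (start p d) h) sB; apply: le_trans.
  rewrite lerN2 /shift; case: d.2.
    by rewrite (_ : _ - _ = h) ?gtr0_norm //; ring.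
  by rewrite (_ : _ - _ = - h) ?normrN ?gtr0_norm //; ring.
have ordX p : X p -> ord g p = - #|leaving X p|%:Z.
  move=> Xp; rewrite /ord (eq_bigr (fun d => if d \in leaving X p then -1 else 0)); last first.
    by move=> d dp; apply: slopeE; exact: slX.
  rewrite -big_mkcondr /= (eq_bigl (mem (leaving X p))); last first.
    by move=> d; rewrite /= !inE andbA andbb.
  by rewrite sumr_const mulNrn natz.
have slnX p : ~ X p -> (forall d, d \in directions p -> exists m, has_slope g p d m) /\
    0 <= ord g p.
  move=> nXp; case: p nXp => [x|[[e t] etP]] nXp.
    have sl d : d \in directions (inl x : pt) -> has_slope g (inl x) d 0.
      move=> dp; have gm := gmove _ _ dp (clX _ _ nXp dp).
      near=> h.
      have h0 : 0 < h by near: h; exact: near0_gt.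
      have he : h < eps by near: h; exact: near0_lt.
      have -> : g (move (inl x) d h) = hat eps (B d.1) (shift d.2 (start (inl x : pt) d) h) by near: h.
      rewrite mul0r addr0 /g asboolF //.
      apply/eqP; rewrite eq_le hat_geN andbT; apply: hat_le => // s sB.
      rewrite lerN2; have [H1 H2] := Heps _ _ sB; have Xs := BX _ _ sB.
      move: dp; rewrite inE /shift /=; case bE: d.2 => /eqP dx.
        have s0 : 0 < s.
          by rewrite ltNge; apply/negP => s0; apply: nXp; rewrite -dx -(edge_pt_le0 _ s0).
        rewrite ler_normr; apply/orP; right; have := H1 s0; lra.
      have s0 : 0 < len d.1 - s.
        by rewrite subr_gt0 ltNge; apply/negP => s0; apply: nXp; rewrite -dx -(edge_pt_ge s0).
      rewrite ler_normr; apply/orP; left; have := H2 s0; lra.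
    split; first by move=> d dp; exists 0; exact: sl.
    by rewrite /ord big1 // => d dp; apply/slopeE/sl.
  have t0 : 0 < t by have /andP[] := etP.
  have tl : t < len e by have /andP[] := etP.
  rewrite -(edge_pt_in etP) in nXp *.
  have tB : t \notin B e by apply/negP => /BX.
  have [m [n [Hm Hn mn]]] := convex_germ_hat eps tB.
  have [d1 E1] := @edge_forward _ G e t (ltW t0) tl.
  have [d2 E2] := @edge_backward _ G e t t0 (ltW tl).
  have s1 : has_slope g (edge_pt e t) (e, true) m.
    have := gmove _ _ d1 (clX _ _ nXp d1); apply: filterS2 Hm => h Hm ->.
    by rewrite gE //= start_inside // /shift Hm.
  have s2 : has_slope g (edge_pt e t) (e, false) n.
    have := gmove _ _ d2 (clX _ _ nXp d2); apply: filterS2 Hn => h Hn ->.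
    by rewrite gE //= start_inside // /shift Hn.
  split; last by rewrite ord_inside // (slopeE s1) (slopeE s2).
  by move=> d; rewrite directions_inside // !inE => /orP[] /eqP ->; [exists m|exists n].
exists g; split => //.
- move=> p d dp; have [Xp|nXp] := pselect (X p); first by eexists; exact: slX.
  by have [H _] := slnX _ nXp; exact: H.
- move=> p; have [Xp|nXp] := pselect (X p).
    by rewrite ordX // subr_ge0; exact: leX.
  by rewrite addr_ge0 //; case: (slnX _ nXp).
- move=> p nXp; rewrite /g asboolF //; case: p nXp => [x|[[e t] etP]] nXp.
    by rewrite oppr_lt0.
  by apply: hat_lt0 => //; apply/negP => /BX; rewrite /= (edge_pt_in etP).
Unshelve. all: by end_near. Qed.

End Bump.

(** * A special open set around a point outside supp|D| *)

Section SpecialSets.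
Variables (R : realType) (G : metric_graph R).
Local Notation pt := (mg_point G).
Implicit Types (p q v w : pt) (d : edge G * bool) (f g : pt -> R).
Implicit Types (S X U W A : set pt) (D E : divisor G).

Lemma component_open A w : open A -> open (connected_component A w).
Proof.
move=> /point_openP oA; apply/point_openP => p d wp dp.
have Ap := connected_component_sub wp.
rewrite (same_connected_component wp); apply: near_component => //; exact: oA.
Qed.

Lemma supp_open D : open (~` supp D).
Proof.
apply/point_openP => p d _ dp; have := near_notin (dom D) dp.
by apply: filterS => h; rewrite mem_dom negbK => /eqP H /=; rewrite /supp /= H eqxx.
Qed.

(** By [connected_germ], near a point outside [W] a direction is either inside [W] or outside it; in
    the second case the nearby points share the component of [p] in the complement. *)
Lemma component_germ W x p d : connected W -> open W ->
  let X := connected_component (~` W) x in d \in directions p ->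
  (X p /\ \forall h \near 0^'+, X (move p d h)) \/
  [/\ \forall h \near 0^'+, ~ X (move p d h) &
      X p -> \forall h \near 0^'+, W (move p d h)].
Proof.
move=> cW /point_openP oW X dp.
have XW q : X q -> ~ W q by exact: connected_component_sub.
have [Wp|nWp] := pselect (W p).
  right; have Wd := oW _ _ Wp dp; split; last by move=> /XW.
  by apply: filterS Wd => h Wh /XW.
have [Wd|nWd] := connected_germ cW nWp dp.
  by right; split=> [|_ //]; apply: filterS Wd => h Wh /XW.
have nc := near_component (A := ~` W) nWp dp nWd.
have [Xp|nXp] := pselect (X p).
  by left; split=> //; rewrite /X (same_connected_component Xp).
right; split => //; apply: filterS nc => h ph Xh; apply: nXp.
by apply: connected_component_trans Xh _; exact: connected_component_sym.
Qed.

Lemma max_slope_le0 g p d : pl g -> (forall q, g q <= g p) ->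
  d \in directions p -> slope g p d <= 0.
Proof.
move=> plg gmax dp; have := plP plg dp; rewrite -(ler_int R) => /near0P[eps eps0 H].
have := gmax (move p d (eps / 2)); rewrite H; [|lra|lra].
by rewrite gerDl pmulr_lle0 //; lra.
Qed.

Lemma near_below g p d (c : R) : pl g -> g p < c -> d \in directions p ->
  \forall h \near 0^'+, g (move p d h) < c.
Proof.
move=> plg gp dp; have := plP plg dp.
have := near0_affine_gt (- (slope g p d)%:~R) (eq_trans (subr_gt0 (g p) c) gp).
by apply: filterS2 => h gh ->; lra.
Qed.

Lemma near_level g p d : pl g -> d \in directions p -> slope g p d = 0 ->
  \forall h \near 0^'+, g (move p d h) = g p.
Proof.
move=> plg dp s0; have := plP plg dp; rewrite s0.
by apply: filterS => h ->; rewrite mul0r addr0.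
Qed.

(* At a maximum of g, every direction along which g is not constant takes a   *)
(* chip of D away.                                                            *)
Lemma max_chips D g p (N : {set edge G * bool}) : pl g -> stays_effective D g ->
  (forall q, g q <= g p) -> N \subset directions p ->
  (forall d, d \in N -> slope g p d != 0) -> #|N|%:Z <= coeff p D.
Proof.
move=> plg effg gmax Np N0; have := effg p.
have : ord g p <= - #|N|%:Z.
  rewrite /ord (big_setID N) /= (finset.setIidPr Np).
  have H1 : \sum_(d in N) slope g p d <= \sum_(d in N) -1.
    apply: ler_sum => d dN; have := N0 d dN; have := max_slope_le0 plg gmax (fintype.subsetP Np d dN).
    lia.
  have H2 : \sum_(d in directions p :\: N) slope g p d <= 0.
    apply: sumr_le0 => d; rewrite inE => /andP[_ dp]; exact: max_slope_le0.
  rewrite -(addr0 (- _)); apply: lerD H2.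
  by apply: le_trans H1 _; rewrite sumr_const mulNrn natz.
move=> H1 H2; rewrite -subr_ge0; apply: le_trans H2 _.
by rewrite lerD2l.
Qed.

(** Going down from the maximum costs a chip, and [D] has none on [W]. *)
Lemma max_locally_constant D g (c : R) W : pl g -> stays_effective D g ->
  (forall q, g q <= c) -> W `<=` ~` supp D ->
  locally_constant_on W [set q | g q = c].
Proof.
move=> plg effg gmax WD p d Wp dp; have [gp|/eqP nc] := pselect (g p = c); last first.
  have {nc}gp : g p < c by rewrite lt_neqAle nc gmax.
  by apply: filterS (near_below plg gp dp) => h gh _; split=> /=; lra.
have D0 : coeff p D = 0 by have := WD _ Wp; rewrite /supp /= => /negP; rewrite negbK => /eqP.
have s0 : slope g p d = 0.
  apply/eqP; apply: contraT => s0.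
  have := @max_chips D g p [set d]%SET plg effg; rewrite gp D0 cards1 => /(_ gmax).
  by rewrite finset.sub1set dp => /(_ isT) H; have : 1%:Z <= 0 by apply: H => i; rewrite inE => /eqP ->.
by apply: filterS (near_level plg dp s0) => h /= -> _; rewrite gp.
Qed.

Lemma ord_constant g (c : R) W q : open W -> W `<=` [set q | g q = c] -> W q ->
  ord g q = 0.
Proof.
move=> /point_openP oW Wc Wq; rewrite /ord big1 // => d dq; apply: slopeE.
apply: filterS (oW _ _ Wq dq) => h Wh.
by rewrite mul0r addr0 (Wc _ Wh) (Wc _ Wq).
Qed.

(** Every move has its maximum at [w], hence is constant on [W] and brings no chip there. *)
Lemma reduced_unmoved D w W : reduced w D -> W w -> connected W -> open W ->
  W `<=` ~` supp D -> W `<=` ~` supp_linsys D.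
Proof.
move=> [effD redD] Ww cW oW WD q Wq [D' [effD' /lin_equivP[g plg cg]]].
have effg : stays_effective D g by move=> p; rewrite -cg; exact: effD'.
have gmax := redD g plg effg.
have WM : W `<=` [set p | g p = g w].
  apply: connected_locally_constant cW (max_locally_constant plg effg gmax WD) _.
  by exists w.
rewrite /supp /= cg (ord_constant oW WM Wq) addr0; exact: WD.
Qed.

Lemma leaving_component W x p d : connected W -> open W ->
  let X := connected_component (~` W) x in X p -> d \in leaving X p ->
  d \in directions p /\ \forall h \near 0^'+, W (move p d h).
Proof.
move=> cW oW X Xp; rewrite inE => /andP[dp /asboolP nX]; split=> //.
case: (component_germ x cW oW dp) => [[_ /near0_absurd]|[_]]; first by case/(_ nX).
exact.
Qed.

Lemma special_avoiding D w : linsys D !=set0 -> ~ supp_linsys D w ->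
  exists W, [/\ special_open W, W w & W `<=` ~` supp_linsys D].
Proof.
move=> [D1 [effD1 D1D]] nw.
have [E [effE ED1 redE]] := exists_reduced w effD1.
have ED := lin_equiv_trans ED1 D1D.
have SE : supp_linsys E = supp_linsys D by rewrite /supp_linsys (linsys_equiv ED).
rewrite -SE in nw *.
have Ew : ~ supp E w by move=> Ew; apply: nw; exists E => //; split => //; exact: lin_equiv_refl.
pose A := ~` supp E; pose W := connected_component A w.
have cW : connected W by exact: component_connected.
have oW : open W by apply: component_open; exact: supp_open.
have Ww : W w by exact: connected_component_refl.
have WA : W `<=` A := @connected_component_sub _ A w.
exists W; split=> //; last exact: reduced_unmoved redE Ww cW oW WA.
split=> //; apply: Or33 => X [x nWx XE].
have Xx : X x by rewrite XE; exact: connected_component_refl.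
(* Otherwise [bump_exists] gives a move that is 0 on [X] and negative at [w]. *)
have [p [Xp lep]] : exists p, X p /\ coeff p E < #|leaving X p|%:Z.
  apply: contrapT => nex.
  have [//||||g [plg effg g0 glt]] := @bump_exists R G E X.
  - move=> p d nXp dp; rewrite XE in nXp *.
    by case: (component_germ x cW oW dp) => [[]|[]].
  - move=> p d Xp dp ndl; rewrite XE in Xp ndl *.
    case: (component_germ x cW oW dp) => [[]//|[nX _]].
    by move: ndl; rewrite inE dp /= => /asboolPn.
  - by move=> p Xp; rewrite leNgt; apply/negP => ?; apply: nex; exists p.
  have := redE.2 g plg effg x; rewrite g0 // leNgt glt //.
  by rewrite XE => /connected_component_sub.
have lv d : d \in leaving X p -> d \in directions p /\ \forall h \near 0^'+, W (move p d h).
  by rewrite XE in Xp *; exact: leaving_component.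
have nWp : ~ W p by move: Xp; rewrite XE => /connected_component_sub.
(* Without a chip, [p] would be joined to [W] off supp E and so belong to [W]. *)
have Ep : 0 < coeff p E.
  rewrite lt_neqAle effE andbT; apply/eqP => E0; apply: nWp.
  have /card_gt0P[d /lv[dp Wd]] : (0 < #|leaving X p|)%N by rewrite -ltz_nat (le_lt_trans _ lep).
  have Ap : A p by rewrite /A /supp /= -E0 eqxx.
  have H : \forall h \near 0^'+, connected_component A p (move p d h).
    by apply: near_component => //; apply: filterS Wd => h /WA.
  have /near0_ex[h _ [ph wh]] : \forall h \near 0^'+, connected_component A p (move p d h) /\ W (move p d h).
    exact: filterS2 H Wd.
  by apply: connected_component_trans wh _; exact: connected_component_sym.
(* At least one chip, and fewer chips than leaving directions. *)
have : (1 < #|leaving X p|)%N by rewrite -ltz_nat; lia.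
move=> /card_gt1P[d1 [d2 [/lv[d1p W1] /lv[d2p W2] ne]]].
have XW q : W q -> ~ X q by move=> Wq; rewrite XE => /connected_component_sub.
exists p.
  split; first exact: subset_closure.
  move=> /point_nbhsP[_ /(_ _ d1p)] H; apply: (near0_absurd H).
  by apply: filterS W1 => h /XW.
apply/outdeg_ge2P; exists d1, d2; split => //.
  by apply: filterS W1 => h /XW.
by apply: filterS W2 => h /XW.
Qed.

End SpecialSets.

(** * Forks of a special set, and fireproof sets of chips *)

Section Cuts.
Variables (R : realType) (G : metric_graph R).
Local Notation pt := (mg_point G).
Implicit Types (e : edge G) (p q v w y : pt) (d : edge G * bool) (f g : pt -> R).
Implicit Types (S X U W A Z C B : set pt) (D E : divisor G) (F : seq pt).

(** Compactness of each edge, by continuous induction: a germ free of [B] adds at most its end point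
    to the list. *)
Lemma locally_finite B : (forall p d, d \in directions p ->
    \forall h \near 0^'+, ~ B (move p d h)) ->
  exists s : seq pt, forall p, B p -> p \in s.
Proof.
move=> HB.
have H e : exists s : seq pt, forall t, 0 <= t -> t <= len e ->
    B (edge_pt e t) -> edge_pt e t \in s.
  pose P (b : R) := exists s : seq pt, forall t, 0 <= t -> t <= b ->
    B (edge_pt e t) -> edge_pt e t \in s.
  have Pext (a b : R) : P a ->
      (forall t, a < t -> t < b -> ~ B (edge_pt e t)) -> P b.
    move=> [s Hs] Hab; exists (edge_pt e b :: s) => t t0 tb Bt; rewrite inE.
    have [ta|ta] := leP t a; first by rewrite Hs ?orbT.
    move: tb; rewrite le_eqVlt => /orP[/eqP ->|tb]; first by rewrite eqxx.
    by have := Hab t ta tb.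
  apply: (real_induction (P := P) (ltW (len_gt0 e))) => //; last exact/ltW/len_gt0.
  - exists [:: edge_pt e 0] => t t0 t1 _.
    by have -> : t = 0 by [apply/eqP; rewrite eq_le t0 t1]; rewrite inE.
  - move=> t t0 tl Pt; have [dp mE] := edge_forward t0 tl.
    have /near0P[eps eps0 He] := HB _ _ dp; apply/near0P; exists eps => // h h0 he.
    apply: Pext Pt _ => u tu uh; have -> : u = t + (u - t) by ring.
    by rewrite -mE; apply: He; lra.
  - move=> t t0 tl Ps; have [dp mE] := edge_backward t0 tl.
    have /near0P[eps eps0 He] := HB _ _ dp.
    pose s := Num.max 0 (t - eps / 2).
    have st : s < t by rewrite gt_max t0; lra.
    have s0 : 0 <= s by rewrite le_max lexx.
    have se : t - eps / 2 <= s by rewrite le_max lexx orbT.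
    apply: Pext (Ps s s0 st) _ => u su ut; have -> : u = t - (t - u) by ring.
    by rewrite -mE; apply: He; lra.
have [s Hs] := choice H.
exists ([seq inl x | x <- enum (vertex G)] ++ flatten [seq s e | e <- enum (edge G)]).
move=> [x|[[e t] etP]] Bp; rewrite mem_cat; apply/orP.
  by left; rewrite map_f // mem_enum.
have t0 : 0 < t by have /andP[] := etP.
have tl : t < len e by have /andP[] := etP.
right; apply/flattenP; exists (s e); first by rewrite map_f // mem_enum.
by rewrite -(edge_pt_in etP) in Bp *; apply: Hs => //; exact: ltW.
Qed.

Lemma pl_max_exists g : pl g -> exists m, forall q, g q <= g m.
Proof.
move=> plg.
have H e : exists c : R, 0 <= c /\ c <= len e /\
    forall t, 0 <= t -> t <= len e -> g (edge_pt e t) <= g (edge_pt e c).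
  have [||c cI cmax] := @EVT_max R (g \o edge_pt e) 0 (len e).
  - exact/ltW/len_gt0.
  - apply: continuous_subspaceT => t; apply: continuous_comp; first exact: edge_pt_continuous.
    exact: pl_continuous.
  move: cI; rewrite in_itv /= => /andP[c0 cl]; exists c; split=> //; split=> // t t0 tl.
  by apply: cmax; rewrite in_itv /= t0.
have [c Hc] := choice H.
pose pos (i : vertex G + edge G) : pt := match i with inl x => inl x | inr e => edge_pt e (c e) end.
have [x0 _] : exists x, x \in vertex G by apply/card_gt0P; exact: vertex_gt0.
case: (@Order.TotalTheory.arg_maxP _ _ _ (inl x0 : vertex G + edge G) xpredT (g \o pos)) => // i _ imax.
exists (pos i) => -[x|[[e t] etP]]; first exact: (imax (inl x)).
have t0 : 0 < t by have /andP[] := etP.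
have tl : t < len e by have /andP[] := etP.
apply: le_trans (imax (inr e) isT); rewrite -(edge_pt_in etP) /=.
by have [_ [_]] := Hc e; apply; exact: ltW.
Qed.

Definition outward U p : {set edge G * bool} :=
  [set d in directions p | `[< \forall h \near 0^'+, U (move p d h) >]]%SET.

Lemma outwardP U p d : reflect (d \in directions p /\ \forall h \near 0^'+, U (move p d h))
  (d \in outward U p).
Proof. by rewrite inE; apply: (iffP andP) => -[? /asboolP]. Qed.

Lemma notin_outward U p d : connected U -> ~ U p -> d \in directions p ->
  d \notin outward U p -> \forall h \near 0^'+, ~ U (move p d h).
Proof.
move=> cU nUp dp dout; case: (connected_germ cU nUp dp) => // Ud.
by move/negP: dout; case; apply/outwardP.
Qed.

Lemma outward_near U p d : connected U -> ~ U p -> d \in directions p ->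
  d \notin outward U p -> \forall h \near 0^'+, outward U (move p d h) = finset.set0.
Proof.
move=> cU nUp dp /(notin_outward cU nUp dp)/near0P[eps eps0 He].
near=> h.
have h0 : 0 < h by near: h; exact: near0_gt.
have he : h < eps by near: h; exact: near0_lt.
have ha : h < ahead p d by near: h; apply: near0_lt; exact: ahead_gt0.
apply/finset.setP => d'; rewrite [RHS]inE; apply/negP => /outwardP[+ Ud'].
rewrite directions_move // !inE => /orP[] /eqP dE; apply: (near0_absurd Ud'); rewrite dE.
  apply/near0P; exists (eps - h); first by rewrite subr_gt0.
  by move=> k k0 ke; rewrite move_move //; apply: He; lra.
apply/near0P; exists h => // k k0 kh.
by rewrite move_rev //; apply: He; lra.
Unshelve. all: by end_near. Qed.

Lemma boundary_finite U : connected U -> open U -> exists s : seq pt,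
  forall p, ~ U p /\ outward U p != finset.set0 -> p \in s.
Proof.
move=> cU /point_openP oU.
apply: (@locally_finite [set p | ~ U p /\ outward U p != finset.set0]) => p d dp.
have [Up|nUp] := pselect (U p).
  by apply: filterS (oU _ _ Up dp) => h Uh [].
have [dout|dout] := boolP (d \in outward U p).
  by have /outwardP[_] := dout; apply: filterS => h Uh [].
by apply: filterS (outward_near cU nUp dp dout) => h H [_]; rewrite H eqxx.
Qed.

(** The boundary points of outdegree at least 2 that [special_open] asks for, read off from the side
    of [U]. *)
Definition forks U : set pt := [set v | ~ U v /\ (2 <= #|outward U v|)%N].

Lemma special_fork U x : special_open U -> U !=set0 -> ~ U x ->
  exists2 v, connected_component (~` U) x v & forks U v.
Proof.
move=> [cU oU alt] U0 nUx.
case: alt => [UE|UE|H]; [by case: U0 => y; rewrite UE|by case: nUx; rewrite UE|].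
have [v bv /outdeg_ge2P[d1 [d2 [ne d1v d2v H1 H2]]]] := H _ (ex_intro2 _ _ x nUx erefl).
have Xv : connected_component (~` U) x v.
  have cl : closed (connected_component (~` U) x) by apply: component_closed; exact: open_closedC.
  by case: bv => + _; rewrite -(closure_id _).1.
have nUv : ~ U v by exact: connected_component_sub Xv.
have out d : d \in directions v -> (\forall h \near 0^'+, ~ connected_component (~` U) x (move v d h)) ->
    d \in outward U v.
  move=> dv Hd; apply/outwardP; split=> //.
  case: (component_germ x cU oU dv) => [[_ /near0_absurd]|[_]]; first by case/(_ Hd).
  exact.
exists v => //; split=> //; apply/card_gt1P; exists d1, d2; split=> //; exact: out.
Qed.

Definition inner p := exists e t, [/\ 0 < t, t < len e & p = edge_pt e t].

Lemma inner_directions p : inner p -> #|directions p| = 2.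
Proof.
by move=> [e [t [t0 tl ->]]]; rewrite directions_inside // cards2 xpair_eqE eqxx.
Qed.

(* Finite sets of chips inside the complement of U which do not stop a fire   *)
(* that enters the complement at the forks of U.                              *)
Definition fireproof U F := [/\ uniq F,
  forall p, p \in F -> [/\ inner p, ~ U p & outward U p = finset.set0] &
  forall C, C !=set0 -> C `<=` [set q | ~ U q /\ q \notin F] ->
    locally_constant_on [set q | ~ U q /\ q \notin F] C -> C `&` forks U !=set0].

(** A nonempty clopen part of the complement contains a whole component, and this has a fork. *)
Lemma fireproof_nil U : special_open U -> U !=set0 -> fireproof U [::].
Proof.
move=> sU U0; split=> // C [x Cx] CK lc.
have [nUx _] := CK _ Cx.
have [v Xv fv] := special_fork sU U0 nUx; exists v; split=> //.
apply: (connected_locally_constant (component_connected (A := ~` U) (x := x))) => //.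
  apply: locally_constant_sub lc => q /connected_component_sub nUq; split=> //.
by exists x; split=> //; exact: connected_component_refl.
Qed.

(** The segment between two chips on one edge is cut off from the rest, so its part outside [U] must
    contain a fork [v]. Being inside an edge, [v] has [U] on both sides, which a connected set
    missing both [v] and a chip on the edge cannot do. *)
Lemma fireproof_edge U F e (t1 t2 : R) : connected U -> open U -> fireproof U F ->
  0 < t1 -> t1 < t2 -> t2 < len e ->
  edge_pt e t1 \in F -> edge_pt e t2 \in F -> False.
Proof.
move=> cU oU [uF HF cut] t10 t12 t2l F1 F2.
have t1l : t1 < len e by lra.
have [dp mE] := edge_forward (ltW t10) t1l.
set p := edge_pt e t1 in F1 dp mE; set d := (e, true) in dp mE.
pose k := t2 - t1.
have ah : ahead p d = len e - t1 by rewrite /ahead start_inside.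
have ka : k < ahead p d by rewrite ah /k; lra.
have pkE : move p d k = edge_pt e t2 by rewrite mE /k; congr edge_pt; ring.
have [ip nUp outp] := HF _ F1; have [_ nUk _] := HF _ F2; rewrite -pkE in nUk F2.
pose Z := [set q | ~ U q /\ q \notin F].
have lcZ : locally_constant_on Z (open_segment p d k).
  by apply: open_segment_locally_constant => //= -[_]; rewrite ?F1 ?F2.
have : (Z `&` open_segment p d k) `&` forks U !=set0.
  apply: cut; last 2 first.
  - by move=> q [].
  - move=> q d' Zq dq; apply: filterS (lcZ q d' Zq dq) => h H Zh.
    by have {}H := H Zh; split=> -[_ /H].
  have nU : \forall h \near 0^'+, ~ U (move p d h).
    by apply: notin_outward => //; rewrite outp inE.
  have k0 : 0 < k by rewrite /k; lra.
  have : \forall h \near (0:R)^'+, (Z `&` open_segment p d k) (move p d h).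
    near=> h.
    have h0 : 0 < h by near: h; exact: near0_gt.
    have hk : h < k by near: h; exact: near0_lt.
    split; last by exists h.
    by split; near: h; [exact: nU|exact: near_notin].
  by move=> /near0_ex[h _ Ch]; exists (move p d h).
move=> [v [[_ [h [h0 hk vE]]] [nUv out2]]].
have ha := lt_trans hk ka.
have outall d' : d' \in directions v -> d' \in outward U v.
  have sub : outward U v \subset directions v by apply/fintype.subsetP => x /outwardP[].
  have -> // : directions v = outward U v.
  apply/eqP; rewrite eq_sym eqEcard sub /=.
  by rewrite vE directions_move // cards2 rev_neq -vE.
have dv : d \in directions v by rewrite vE directions_move // !inE eqxx.
have rv : rev d \in directions v by rewrite vE directions_move // !inE eqxx orbT.
have /outwardP[_ U1] := outall _ dv; have /outwardP[_ U2] := outall _ rv.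
(* [U] misses [p] and [v] but has points between them, so it lies between them, although it also has
   points just beyond [v]. *)
have lcU : locally_constant_on U (open_segment p d h).
  by apply: open_segment_locally_constant => //; rewrite -vE.
have UO : U `<=` open_segment p d h.
  apply: connected_locally_constant cU lcU _.
  have : \forall x \near (0:R)^'+, U (move v (rev d) x) /\ x < h.
    by apply: filterS2 U2 (near0_lt h0).
  move=> /near0_ex[x x0 [Ux xh]]; exists (move v (rev d) x); split=> //.
  exists (h - x); split; [lra|lra|by rewrite vE move_rev].
have : \forall x \near (0:R)^'+, U (move v d x) /\ h + x < ahead p d.
  have ah0 : 0 < ahead p d - h by lra.
  apply: filterS2 U1 (near0_lt ah0).
  by move=> x Ux xa; split=> //; lra.
move=> /near0_ex[x x0 [Ux xa]]; have [h' [h'0 h'h E]] := UO _ Ux.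
move: E; rewrite vE move_move // => E.
have := move_injl dp _ xa E; lra.
Unshelve. all: by end_near. Qed.

(** At most one chip per edge; this bound provides a fireproof set of maximal size. *)
Lemma fireproof_size U F : connected U -> open U -> fireproof U F ->
  (size F <= #|{: option (edge G)}|)%N.
Proof.
move=> cU oU fF; have [uF HF _] := fF.
pose ed p : option (edge G) := if p is inr x then Some (val x).1 else None.
have edE e t : 0 < t -> t < len e -> ed (edge_pt e t) = Some e.
  by move=> t0 tl; rewrite (edge_pt_in (introT andP (conj t0 tl))).
have uE : uniq (map ed F).
  rewrite map_inj_in_uniq // => p q pF qF.
  have [[e [t [t0 tl pE]]] _ _] := HF _ pF; have [[e' [t' [t0' tl' qE]]] _ _] := HF _ qF.
  rewrite pE qE !edE // => -[ee]; subst e'.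
  have [tt|tt|-> //] := ltgtP t t'.
    by exfalso; apply: (fireproof_edge cU oU fF t0 tt tl'); rewrite -?pE -?qE.
  by exfalso; apply: (fireproof_edge cU oU fF t0' tt tl); rewrite -?pE -?qE.
by rewrite -(size_map ed) -(card_uniqP uE) max_card.
Qed.

Lemma fireproof_max U : special_open U -> U !=set0 ->
  exists2 F, fireproof U F & forall F', fireproof U F' -> (size F' <= size F)%N.
Proof.
move=> sU U0; have [cU oU _] := sU.
have ex0 : exists n, `[< exists2 F, fireproof U F & size F = n >].
  by exists 0; apply/asboolP; exists [::] => //; exact: fireproof_nil.
have ub n : `[< exists2 F, fireproof U F & size F = n >] -> (n <= #|{: option (edge G)}|)%N.
  by move=> /asboolP[F fF <-]; exact: fireproof_size fF.
case: (ex_maxnP ex0 ub) => n /asboolP[F fF sF] maxn; exists F => // F' fF'.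
by rewrite sF; apply: maxn; apply/asboolP; exists F'.
Qed.

End Cuts.

(** * Extending fireproof sets, and the divisor that keeps its chips out of U *)

Section Separation.
Variables (R : realType) (G : metric_graph R).
Local Notation pt := (mg_point G).
Implicit Types (e : edge G) (p q v w y : pt) (d : edge G * bool) (f g : pt -> R).
Implicit Types (S X U W A Z C B : set pt) (D E : divisor G) (F : seq pt).

Lemma inner_move p d h : d \in directions p -> 0 < h -> h < ahead p d -> inner (move p d h).
Proof.
move=> dp h0 ha; have /andP[a b] := shift_in dp h0 ha.
by exists d.1, (shift d.2 (start p d) h); rewrite moveE.
Qed.

(* The closed curve formed by y and a path in W between the two directions at *)
(* y stays connected when the point p on it is removed.                       *)
Lemma fireproof_cons U W F y d1 d2 h : connected U -> connected W -> open W ->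
  fireproof U F -> W `<=` [set q | ~ U q /\ q \notin F] ->
  ~ W y -> ~ U y -> y \notin F ->
  d1 != d2 -> d1 \in directions y -> d2 \in directions y ->
  0 < h -> h < ahead y d1 ->
  (forall k, 0 < k -> k <= h -> W (move y d1 k)) ->
  (\forall k \near 0^'+, W (move y d1 (h + k))) ->
  (\forall k \near 0^'+, W (move y d2 k)) ->
  fireproof U (move y d1 h :: F).
Proof.
move=> cU cW oW' [uF HF cut] WZ nWy nUy nFy d12 dy1 dy2 h0 ha Wseg Wahead W2.
have /point_openP oW := oW'.
set p := move y d1 h; pose Z := [set q | ~ U q /\ q \notin F].
have Wp : W p by apply: Wseg.
have yp : y <> p by move=> E; apply: nWy; rewrite E.
have outW q : W q -> outward U q = finset.set0.
  move=> Wq; apply/finset.setP => d; rewrite [RHS]inE; apply/negP => /outwardP[dq Ud].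
  apply: (near0_absurd Ud); apply: filterS (oW _ _ Wq dq) => k Wk.
  by case: (WZ _ Wk).
have [nUp nFp] := WZ _ Wp.
split.
- by rewrite /= nFp.
- move=> q; rewrite inE => /orP[/eqP ->|/HF //].
  by split=> //; [exact: inner_move|exact: outW].
move=> C [c0 Cc0] CZ' lc; apply: contrapT => CV.
set Z' := [set q | ~ U q /\ q \notin p :: F] in CZ' lc.
have ZZ' q : Z q -> q <> p -> Z' q.
  by move=> [nUq nFq] /eqP qp; split=> //; rewrite inE negb_or qp.
have Z'Z q : Z' q -> Z q /\ q <> p.
  by move=> [nUq]; rewrite inE negb_or => /andP[/eqP qp nFq].
have WZ' q : W q -> q <> p -> Z' q by move=> Wq; apply: ZZ'; exact: WZ.
have Z'y : Z' y by apply: ZZ'.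
have seg_eq k : 0 < k -> move y d1 k = p -> k = h.
  by move=> k0 /esym /(move_injl dy1 h0 ha).
(* On the near side of [p], the segment from [y] carries the value of [C] at [y]. *)
have back k : 0 <= k -> k < h -> C (move y d1 k) <-> C y.
  move=> k0 kh; pose I := move y d1 @` `[0, h[.
  have cI : connected I by apply: segment_connected; exact: interval_is_interval.
  apply: (locally_constantP cI (C := C)).
  - apply: locally_constant_sub lc => q [x /= + xq]; rewrite in_itv /= -xq.
    rewrite le_eqVlt => /andP[/orP[/eqP <-|x0] xh]; first by rewrite move0.
    by apply: WZ'; [apply: Wseg => //; exact: ltW|move=> /(seg_eq _ x0); lra].
  - by exists k => //=; rewrite in_itv /= k0.
  - by exists 0; rewrite ?move0 //= in_itv /= lexx.
have near_y : \forall k \near 0^'+, W (move y d2 k) /\ (C (move y d2 k) <-> C y).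
  have H1 := lc _ _ Z'y dy2; have H2 := near_neq p dy2.
  by apply: filterS3 W2 H1 H2 => k Wk H kp; split=> //; apply: H; exact: WZ'.
have dirp d : d \in directions p -> d = d1 \/ d = rev d1.
  by rewrite directions_move // !inE => /orP[] /eqP; [left|right].
(* On the far side as well. Otherwise the set [C2], made of the points off the segment from [y] to
   [p] where [C] agrees with [y], would be clopen in [W]; it contains the points of [W] near [y]
   along [d2], but not [p]. *)
have forward : \forall k \near 0^'+, C (move y d1 (h + k)) <-> C y.
  move/near0P: Wahead => [eps eps0 We].
  pose dl := Num.min eps (ahead y d1 - h).
  have dl0 : 0 < dl by rewrite lt_min eps0; lra.
  have dle : dl <= eps by rewrite ge_min lexx.
  pose J := move y d1 @` `]h, (h + dl)[.
  have cJ : connected J by apply: segment_connected; exact: interval_is_interval.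
  have lcJ : locally_constant_on J C.
    apply: locally_constant_sub lc => q [x /= + xq]; rewrite in_itv /= -xq => /andP[hx xd].
    apply: WZ'; last by move=> /seg_eq E; have := E (lt_trans h0 hx); lra.
    have -> : x = h + (x - h) by ring.
    by apply: We; lra.
  have Jx x : 0 < x -> x < dl -> J (move y d1 (h + x)).
    by move=> x0 xd; exists (h + x) => //=; rewrite in_itv /=; apply/andP; split; lra.
  have dl20 : 0 < dl / 2 by lra.
  have dl2 : dl / 2 < dl by lra.
  have [same|diff] := pselect (C (move y d1 (h + dl / 2)) <-> C y).
    apply/near0P; exists dl => // k k0 kd.
    exact: iff_trans (locally_constantP cJ lcJ (Jx _ k0 kd) (Jx _ dl20 dl2)) same.
  have {}diff k : 0 < k -> k < dl -> ~ (C (move y d1 (h + k)) <-> C y).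
    move=> k0 kd same; apply: diff.
    exact: iff_trans (locally_constantP cJ lcJ (Jx _ dl20 dl2) (Jx _ k0 kd)) same.
  pose C2 := [set q | [/\ ~ open_segment y d1 h q, q <> p & C q <-> C y]].
  have lc2 : locally_constant_on W C2.
    move=> q d Wq dq; have [Oq|nOq] := pselect (open_segment y d1 h q).
      have /point_openP oO := open_segment_open dy1 (ltW ha).
      by apply: filterS (oO _ _ Oq dq) => k Ok _; split=> -[].
    have [qp|qp] := pselect (q = p).
      subst q; case: (dirp d dq) => ->.
        apply/near0P; exists dl => // k k0 kd _; rewrite move_move //.
        by split=> [[_ _ /(diff k k0 kd)]//|[_ pp _]]; case: pp.
      apply/near0P; exists h => // k k0 kh _; rewrite move_rev //.
      split=> [[nO _ _]|[_ pp _]]; last by case: pp.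
      by exfalso; apply: nO; exists (h - k); split; [lra|lra|].
    have qy : q <> y by move=> E; apply: nWy; rewrite -E.
    have H1 := open_segment_far dy1 ha dq qy qp nOq.
    have H2 := near_neq p dq; have H3 := lc _ _ (WZ' _ Wq qp) dq.
    apply: filterS3 H1 H2 H3 => k nOk kp H Wk.
    have {}H := H (WZ' _ Wk kp).
    by split=> -[_ _ E]; split=> //; [apply: iff_trans E; exact: iff_sym|exact: iff_trans E].
  have : C2 p; last by case.
  apply: (connected_locally_constant cW lc2) => //.
  have H2 := near_neq p dy2; have H3 := @near0_gt R.
  have : \forall k \near (0:R)^'+, [/\ W (move y d2 k) /\ (C (move y d2 k) <-> C y),
     move y d2 k <> p & 0 < k] by apply: filterS3 near_y H2 H3.
  move=> /near0_ex[k _ [[Wk Ck] kp k0]]; exists (move y d2 k); split=> //; split=> //.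
  move=> [x [x0 xh E]]; move: d12.
  by rewrite (move_dir_inj dy1 dy2 x0 (lt_trans xh ha) k0 (esym E)) eqxx.
(* [C] filled in at [p] by its value at [y] is clopen in [Z], hence contains a fork of [U]. This is
   not [p], which has [W] all around it. *)
pose C1 := [set q | (q = p /\ C y) \/ (q <> p /\ C q)].
have C1p : C1 p <-> C y by split=> [[[]//|[]//]|Cy]; left.
have C1q q : q <> p -> C1 q <-> C q by move=> qp; split=> [[[]//|[]//]|Cq]; right.
have [v [C1v fv]] : C1 `&` forks U !=set0.
  apply: cut.
  - have [_ cp] := Z'Z _ (CZ' _ Cc0); exists c0; exact/C1q.
  - by move=> q [[-> _]|[_ Cq]]; [split|have [] := Z'Z _ (CZ' _ Cq)].
  move=> q d Zq dq; have H2 := near_neq p dq.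
  have [qp|qp] := pselect (q = p); last first.
    apply: filterS2 H2 (lc _ _ (ZZ' _ Zq qp) dq) => k kp H Zk.
    have {}H := H (ZZ' _ Zk kp).
    by apply: iff_trans (C1q _ kp) _; apply: iff_trans H _; exact: iff_sym (C1q _ qp).
  subst q; case: (dirp d dq) H2 => -> H2.
    apply: filterS2 H2 forward => k kp H _; rewrite move_move // in kp *.
    by apply: iff_trans (C1q _ kp) _; apply: iff_trans H _; exact: iff_sym.
  have := near0_lt h0; have := @near0_gt R; apply: filterS3 H2 => k kp k0 kh _.
  rewrite move_rev // in kp *; apply: iff_trans (C1q _ kp) _.
  by apply: iff_trans (iff_sym C1p); apply: back; lra.
have [vp|vp] := pselect (v = p).
  by case: fv; rewrite vp outW // cards0.
by apply: CV; exists v; split=> //; exact/C1q.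
Qed.

(** Such a [W] would have a fork [y] in the component of its complement that contains a point of
    [U], and a point of [W] close to [y] could be added to [F] by [fireproof_cons]. *)
Lemma fireproof_max_meets U F W : special_open U -> U !=set0 -> fireproof U F ->
  (forall F', fireproof U F' -> (size F' <= size F)%N) ->
  special_open W -> W `&` ~` U !=set0 ->
  W `<=` [set q | (~ U q -> outward U q = finset.set0) /\ q \notin F] -> False.
Proof.
move=> [cU oU' _] [u Uu] fF maxF sW [a [Wa nUa]] WH.
have [cW oW' _] := sW.
have /point_openP oU := oU'; have /point_openP oW := oW'.
(* [W] is connected and avoids the boundary of [U], so it lies on one side. *)
have WU q : W q -> ~ U q.
  move=> Wq Uq; apply: nUa; apply: (connected_locally_constant cW (C := U)) => //; last by exists q.
  move=> p d Wp dp; have [Up|nUp] := pselect (U p).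
    by apply: filterS (oU _ _ Up dp) => h Uh _.
  have [outp _] := WH _ Wp.
  have := notin_outward cU nUp dp; rewrite outp // inE => /(_ isT).
  by apply: filterS => h nUh _.
have W0 : W !=set0 by exists a.
have [y Yy [nWy /card_gt1P[d1 [d2 [/outwardP[dy1 W1] /outwardP[dy2 W2] d12]]]]] :=
  special_fork sW W0 (fun Wu => WU _ Wu Uu).
have nUy : ~ U y.
  move=> Uy; apply: (near0_absurd W1); apply: filterS (oU _ _ Uy dy1) => h Uh /WU.
  exact.
have [uF HF _] := fF.
have nFy : y \notin F.
  (* A chip is an inner point, so both directions at [y] would enter [W]. Then [y] alone would be
     the component of [u] in the complement of [W]. *)
  apply/negP => Fy; have [iy _ _] := HF _ Fy.
  have dirs : directions y = [set d1; d2]%SET.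
    apply/eqP; rewrite eq_sym eqEcard (inner_directions iy) cards2 d12 andbT.
    by apply/fintype.subsetP => d; rewrite !inE => /orP[] /eqP ->.
  suff : [set y] u by move=> /= E; apply: nUy; rewrite -E.
  apply: (connected_locally_constant (component_connected (A := ~` W) (x := u)) (C := [set y])).
  - move=> q d Yq dq; have [qy|qy] := pselect (q = y).
      move: dq; rewrite qy dirs !inE => /orP[] /eqP ->.
        by apply: filterS W1 => h Wh /connected_component_sub.
      by apply: filterS W2 => h Wh /connected_component_sub.
    by apply: filterS (near_neq y dq) => h hy _; split.
  - by exists y.
  - by apply: connected_component_refl => /WU.
have [eps eps0 Weps] := (near0P _).1 W1.
(* Half of the available length, so that [W] continues beyond the new chip. *)
pose h := Num.min eps (ahead y d1) / 2.
have m0 : 0 < Num.min eps (ahead y d1) by rewrite lt_min eps0 ahead_gt0.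
have m1 : Num.min eps (ahead y d1) <= eps by rewrite ge_min lexx.
have m2 : Num.min eps (ahead y d1) <= ahead y d1 by rewrite ge_min lexx orbT.
have h0 : 0 < h by rewrite /h; lra.
have he : h < eps by rewrite /h; lra.
have ha : h < ahead y d1 by rewrite /h; lra.
have := maxF (move y d1 h :: F); rewrite /= ltnn => H.
suff : false by []; apply: H.
apply: (fireproof_cons (W := W) (d1 := d1) (d2 := d2)) => //.
- by move=> q Wq; split; [exact: WU|case: (WH _ Wq)].
- by move=> k k0 kh; apply: Weps => //; exact: le_lt_trans he.
- by apply/near0P; exists (eps - h); [lra|move=> k k0 ke; apply: Weps; lra].
Qed.

(** The boolean read as an integer withdraws one chip at each fork, which then cannot pay for all
    its directions into [U]. *)
Definition fork_chips U F p : int :=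
  (if `[< U p >] then 0 else #|outward U p|%:Z - (2 <= #|outward U p|)%N%:Z)
  + (p \in F)%:Z.

Lemma fork_chips_support U F : connected U -> open U ->
  exists s : seq pt, forall p, p \notin s -> fork_chips U F p = 0.
Proof.
move=> cU oU; have [s Hs] := boundary_finite cU oU; exists (s ++ F) => p.
rewrite mem_cat negb_or => /andP[ps /negbTE pF]; rewrite /fork_chips pF addr0.
have [Up|nUp] := pselect (U p); first by rewrite asboolT.
rewrite asboolF //; have [->|out] := eqVneq (outward U p) finset.set0; first by rewrite cards0.
by move: ps; rewrite Hs.
Qed.

(** Let [M] be the maximal set of a move. If [M] meets [U], the move is constant on [U] and brings
    no chip there. Otherwise each point of [M] pays for its directions into [U]: forks cannot, and
    other points outside [F] have no chip left for a further direction. So [M] minus [F] is clopen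
    in the complement of [U] minus [F] and contains no fork, hence is empty. Then [M] consists of
    points of [F], whose single chip does not pay for two directions. *)
Lemma fork_divisor U F : special_open U -> U !=set0 -> fireproof U F ->
  exists D : divisor G, [/\ effective D,
   forall p, ~ U p -> (outward U p != finset.set0) || (p \in F) -> supp D p &
   U `<=` ~` supp_linsys D].
Proof.
move=> [cU oU' _] [u0 Uu0] [uF HF cut].
have /point_openP oU := oU'.
have [s s0] := fork_chips_support F cU oU'.
have cE := coeff_divisor_of s0.
set D := divisor_of _ in cE.
have effD : effective D.
  move=> p; rewrite cE /fork_chips; case: asboolP => _; first by case: (p \in F).
  by case: (p \in F); lia.
have UD : U `<=` ~` supp D.
  move=> p Up; have /negbTE pF : p \notin F by apply/negP => /HF[].
  by rewrite /supp /= cE /fork_chips asboolT // pF.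
exists D; split=> //.
  move=> p nUp; rewrite /supp /= cE /fork_chips asboolF // -cards_eq0.
  by case: (p \in F); rewrite ?orbT ?orbF; lia.
move=> q Uq [D' [effD' /lin_equivP[g plg cg]]].
have effg : stays_effective D g by move=> p; rewrite -cg; exact: effD'.
have [m gmax] := pl_max_exists plg.
pose M := [set p | g p = g m].
have gmaxM p : M p -> forall x, g x <= g p by move=> ->.
suff UM : U `<=` M.
  rewrite /supp /= cg (ord_constant oU' UM Uq) addr0; exact: UD.
apply: (connected_locally_constant cU (max_locally_constant plg effg gmax UD)).
apply: contrapT => nUM.
have nU p : M p -> ~ U p by move=> Mp Up; apply: nUM; exists p.
have moves p d : M p -> d \in directions p -> (\forall h \near 0^'+, ~ M (move p d h)) ->
    slope g p d != 0.
  move=> Mp dp nM; apply/eqP => s1; apply: (near0_absurd nM).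
  by apply: filterS (near_level plg dp s1) => h E; case; rewrite /M /= E.
have out_moves p d : M p -> d \in outward U p -> slope g p d != 0.
  move=> Mp /outwardP[dp Ud]; apply: moves => //.
  by apply: filterS Ud => h Uh /nU.
have out_le p : M p -> #|outward U p|%:Z <= coeff p D.
  move=> Mp; apply: (max_chips plg effg (gmaxM _ Mp)).
    by apply/fintype.subsetP => d /outwardP[].
  by move=> d; exact: out_moves.
have notF p : p \in F -> coeff p D = 1.
  by move=> /[dup] pF /HF[_ nUp out]; rewrite cE /fork_chips asboolF // out cards0 pF.
have nfork p : M p -> ~ forks U p.
  move=> Mp [nUp two]; have := out_le _ Mp.
  have [/HF[_ _ out]|pF] := boolP (p \in F); first by rewrite out cards0 in two.
  by rewrite cE /fork_chips asboolF // (negbTE pF) two; lia.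
pose Z := [set q | ~ U q /\ q \notin F].
have lcM : locally_constant_on Z (M `&` Z).
  move=> p d [nUp pF] dp; have [Mp|nMp] := pselect (M p); last first.
    have gp : g p < g m by rewrite lt_neqAle gmax andbT; apply/eqP.
    by apply: filterS (near_below plg gp dp) => h; rewrite lt_neqAle => /andP[/eqP ne _] _; split=> -[].
  have [dout|dout] := boolP (d \in outward U p).
    by have /outwardP[_] := dout; apply: filterS => h Uh [].
  have s1 : slope g p d = 0.
    apply/eqP; apply: contraT => s1.
    have : #|d |: outward U p|%:Z <= coeff p D.
      apply: (max_chips plg effg (gmaxM _ Mp)).
        by apply/fintype.subsetP => x; rewrite !inE => /orP[/eqP ->|/andP[]].
      by move=> x; rewrite in_setU1 => /orP[/eqP ->|]; [|exact: out_moves].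
    rewrite cardsU1 dout cE /fork_chips asboolF // (negbTE pF).
    move: (#|_|) => n; rewrite add1n addr0 => H; exfalso; move: H.
    by case: (2 <= n)%N => /=; lia.
  apply: filterS (near_level plg dp s1) => h E Zh; split=> // _; split=> //.
  by rewrite /M /= E.
have MF : M `&` Z = set0.
  apply/eqP; apply: contrapT => /negP/set0P MZ.
  have [v [[Mv _] fv]] : (M `&` Z) `&` forks U !=set0.
    by apply: cut => // p [].
  exact: nfork fv.
have mF : m \in F.
  apply: contraT => mF; have : (M `&` Z) m by split=> //; split=> //; exact: nU.
  by rewrite MF.
have [im nUm outm] := HF _ mF.
have := max_chips plg effg gmax (fintype.subxx (directions m)).
rewrite (inner_directions im) notF // => H; suff : 2%:Z <= 1 by [].
apply: H => d dm; apply: (moves m) => //.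
have nUd : \forall h \near 0^'+, ~ U (move m d h).
  by apply: (notin_outward cU nUm dm); rewrite outm inE.
apply: filterS2 nUd (near_notin F dm) => h nUh nFh Mh.
have : (M `&` Z) (move m d h) by [].
by rewrite MF.
Qed.

Lemma calL_special A v : A !=set0 -> calL A v ->
  forall U, special_open U -> U v -> A `&` U !=set0.
Proof.
move=> [a0 Aa0] Lv U sU Uv; apply: contrapT => AU.
have nU a : A a -> ~ U a by move=> Aa Ua; apply: AU; exists a.
have U0 : U !=set0 by exists v.
have [F fF maxF] := fireproof_max sU U0.
have [D [effD suppD UD]] := fork_divisor sU U0 fF.
(* A point of [A] outside supp|D| would have a special neighbourhood [W] avoiding supp D, hence
   avoiding both the boundary of [U] and [F]. *)
apply: (UD v Uv); apply: Lv => a Aa; apply: contrapT => nDa.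
have D0 : linsys D !=set0 by exists D; split=> //; exact: lin_equiv_refl.
have [W [sW Wa WD]] := special_avoiding D0 nDa.
have nsupp q : W q -> ~ supp D q.
  by move=> /WD nq Dq; apply: nq; exists D => //; split=> //; exact: lin_equiv_refl.
apply: (fireproof_max_meets sU U0 fF maxF sW).
  by exists a; split=> //; exact: nU.
move=> q Wq; split.
  move=> nUq; apply/eqP; apply: contraT => out; case: (nsupp q Wq).
  by apply: suppD; rewrite ?out.
apply/negP => qF; have [_ nUq _] : [/\ inner q, ~ U q & outward U q = finset.set0] by case: fF => _ + _; apply.
by case: (nsupp q Wq); apply: suppD => //; rewrite qF orbT.
Qed.

Lemma special_calL A v : A !=set0 ->
  (forall U, special_open U -> U v -> A `&` U !=set0) -> calL A v.
Proof.
move=> [a Aa] H D AD; apply: contrapT => nDv.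
have D0 : linsys D !=set0 by have [D' lD _] := AD _ Aa; exists D'.
have [W [sW Wv WD]] := special_avoiding D0 nDv.
by have [b [Ab Wb]] := H W sW Wv; apply: (WD b Wb); exact: AD.
Qed.

End Separation.

(** * Rank, and exchange of test points *)

Section Rank.
Variables (R : realType) (G : metric_graph R).
Local Notation pt := (mg_point G).
Implicit Types (p q v : pt) (A U : set pt) (D E F : divisor G).

Lemma effective_deg0 E : effective E -> deg E = 0 -> E = 0.
Proof.
move=> effE dE; apply: divisorP => p; rewrite coeff0; apply/eqP.
by rewrite eq_le effE -dE deg_ge_coeff.
Qed.

Lemma effective_point p : effective (<< p >> : divisor G).
Proof. by move=> q; rewrite coeffU mul1r. Qed.

Lemma effectiveD E F : effective E -> effective F -> effective (E + F).
Proof. by move=> effE effF p; rewrite coeffD addr_ge0. Qed.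

Lemma supp_point p q : supp (<< p >> : divisor G) q -> q = p.
Proof. by rewrite /supp /= coeffU mul1r; case: (p =P q). Qed.

Lemma suppD E F p : supp (E + F) p -> supp E p \/ supp F p.
Proof.
rewrite /supp /= coeffD; case: (eqVneq (coeff p E) 0) => [->|]; last by left.
by rewrite add0r; right.
Qed.

Lemma effective_decomp E (n : nat) : effective E -> deg E = n.+1%:Z ->
  exists p F, [/\ supp E p, effective F, deg F = n%:Z & E = F + << p >>].
Proof.
move=> effE dE.
have [p Ep] : exists p, supp E p.
  apply: contrapT => N; have E0 : E = 0.
    apply: divisorP => p; rewrite coeff0; apply/eqP; apply: contraT => Ep.
    by case: N; exists p.
  by rewrite E0 deg0 in dE.
exists p, (E - << p >>); split=> //.
- move=> q; rewrite coeffB coeffU mul1r; case: eqP => [<-|_]; last by rewrite subr0.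
  have := effE p; move: Ep; rewrite /supp /=; move: (coeff p E) => c; lia.
- by rewrite degB degU dE; lia.
- by rewrite subrK.
Qed.

Lemma linsys_point D p : linsys (D - << p >>) !=set0 <-> supp_linsys D p.
Proof.
split=> [[E [effE ED]]|[E [effE ED] Ep]].
  exists (E + << p >>).
    split; first by apply: effectiveD effE (effective_point p).
    by move: ED => [f [Hf fE]]; exists f; split=> //; rewrite -fE opprB addrA.
  rewrite /supp /= coeffD coeffU eqxx mulr1 gt_eqF //.
  by rewrite ltr_wpDl.
exists (E - << p >>); split.
  move=> q; rewrite coeffB coeffU mul1r; case: eqP => [<-|_]; last by rewrite subr0.
  have := effE p; move: Ep; rewrite /supp /=; move: (coeff p E) => c; lia.
by move: ED => [f [Hf fE]]; exists f; split=> //; rewrite -fE opprB addrA subrK.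
Qed.

Definition rank_ge A D (s : nat) := forall E, effective E -> deg E = s%:Z ->
  supp E `<=` A -> linsys (D - E) !=set0.

Lemma rank_ge0 A D : linsys D !=set0 -> rank_ge A D 0.
Proof. by move=> D0 E effE dE _; rewrite (effective_deg0 effE dE) subr0. Qed.

Lemma rank_geS A D s : A !=set0 -> rank_ge A D s.+1 -> rank_ge A D s.
Proof.
move=> [a Aa] H E effE dE sE.
have /linsys_point : linsys (D - E - << a >>) !=set0; last by case=> F lF _; exists F.
rewrite -addrA -opprD; apply: H.
- exact: effectiveD effE (effective_point a).
- by rewrite degD degU dE; lia.
- by move=> p /suppD[/sE //|/supp_point ->].
Qed.

Lemma rank_ge_le A D s t : A !=set0 -> (s <= t)%N -> rank_ge A D t -> rank_ge A D s.
Proof.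
move=> A0 /subnK <-; elim: (t - s)%N => // n IH; rewrite addSn => /(rank_geS A0).
exact: IH.
Qed.

(** Tested on s chips at one point of [A]. It bounds the candidates for the rank, so that the [xget]
    of [rank_on] has a witness. *)
Lemma rank_ge_bound A D s : A !=set0 -> rank_ge A D s -> s%:Z <= deg D.
Proof.
move=> [a Aa] H.
have [E [effE ED]] : linsys (D - << s%:Z *g a >>) !=set0.
  apply: H; first by move=> p; rewrite coeffU mulr_ge0.
    by rewrite degU.
  by move=> p; rewrite /supp /= coeffU; case: (a =P p) => [<- //|_]; rewrite mulr0 eqxx.
by have := deg_ge0 effE; rewrite (lin_equiv_deg ED) degB degU subr_ge0.
Qed.

Lemma rank_onP A D : A !=set0 -> linsys D !=set0 ->
  forall s : nat, s%:Z <= rank_on A D <-> rank_ge A D s.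
Proof.
move=> A0 D0; rewrite /rank_on asboolF; last by move=> DE; case: D0 => E; rewrite DE.
have ex0 : exists n, `[< rank_ge A D n >] by exists 0; apply/asboolP; exact: rank_ge0.
have ub n : `[< rank_ge A D n >] -> (n <= absz (deg D))%N.
  by move=> /asboolP/(rank_ge_bound A0); lia.
have ex : exists r, [set r : int | forall s : nat, s%:Z <= r <-> rank_ge A D s] r.
  case: (ex_maxnP ex0 ub) => n /asboolP Hn maxn; exists n%:Z => s; split.
    by rewrite lez_nat => sn; exact: rank_ge_le Hn.
  by move=> Hs; rewrite lez_nat; apply: maxn; apply/asboolP.
exact: (xgetPex (-1) ex).
Qed.

(** [E] is the part of the test divisor still to be replaced and [F] the part already in [A]. A
    point x of [E] may be removed from a linear system as soon as every point of [A] may, because x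
    is in L(A); the total degree n + k stays the same. *)
Lemma rank_ge_exchange A D k : A !=set0 -> (forall v, calL A v) ->
  forall n E F, rank_ge A D (n + k) -> effective E -> deg E = k%:Z ->
  effective F -> deg F = n%:Z -> supp F `<=` A -> linsys (D - (E + F)) !=set0.
Proof.
move=> A0 LA; elim: k => [|k IH] n E F H effE dE effF dF sF.
  by rewrite (effective_deg0 effE dE) add0r; apply: H; rewrite ?addn0.
have [x [E' [_ effE' dE' ->]]] := effective_decomp effE dE.
have -> : D - (E' + << x >> + F) = D - (E' + F) - << x >> by rewrite addrAC opprD addrA.
apply/linsys_point; apply: LA => a Aa; apply/linsys_point.
have -> : D - (E' + F) - << a >> = D - (E' + (F + << a >>)) by rewrite addrA [in RHS]opprD addrA.
apply: (IH n.+1) => //.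
- by rewrite addSnnS.
- exact: effectiveD effF (effective_point a).
- by rewrite degD degU dF; lia.
- by move=> p /suppD[/sF //|/supp_point ->].
Qed.

(** The inclusion of [A] in supp|D| says that D has rank at least 1 on [A]; if the two ranks agree,
    every point is in supp|D|. The other direction is [rank_ge_exchange] with nothing yet in [A]. *)
Lemma rank_determiningP A : A !=set0 -> rank_determining A <-> forall v, calL A v.
Proof.
move=> A0; have T0 : [set: pt] !=set0 by case: A0 => a _; exists a.
split=> [rdA v D AD|LA D].
  have D0 : linsys D !=set0 by case: A0 => a /AD[E lE _]; exists E.
  have A1 : rank_ge A D 1.
    move=> E effE dE sE; have [a [F [Ea effF /(effective_deg0 effF) F0 EE]]] :=
      effective_decomp effE dE.
    by rewrite EE F0 add0r; apply/linsys_point/AD/sE.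
  have : rank_ge setT D 1.
    by apply/(rank_onP T0 D0); rewrite -[rank_on _ _]/(rank D) rdA; apply/rank_onP.
  move=> /(_ << v >>) H; apply/linsys_point; apply: H => //; last by rewrite degU.
  exact: effective_point.
rewrite /rank /rank_on; case: asboolP => // _; congr (xget _ _).
apply/seteqP; split=> r /= H s; split=> [/H Hs|Hs].
- by move=> E effE dE _; apply: Hs.
- apply/H => E effE dE _; have := @rank_ge_exchange A D s A0 LA 0 E 0 Hs effE dE.
  rewrite addr0; apply; [by move=> p; rewrite coeff0|exact: deg0|].
  by move=> p; rewrite /supp /= coeff0 eqxx.
- move=> E effE dE _; have := @rank_ge_exchange A D s A0 LA 0 E 0 Hs effE dE.
  rewrite addr0; apply; [by move=> p; rewrite coeff0|exact: deg0|].
  by move=> p; rewrite /supp /= coeff0 eqxx.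
- by apply/H => E effE dE _; apply: Hs.
Qed.

End Rank.

Theorem theorem3p16 (R : realType) (G : metric_graph R) (v : mg_point G)
    (A : set (mg_point G)) (A0 : A !=set0) :
  [/\ calL A v <-> (forall U, special_open U -> U v -> A `&` U !=set0),
      calL A = \bigcap_(U in [set U | special_open U /\ U `&` A = set0]) ~` U &
      rank_determining A <->
        (forall U, special_open U -> U !=set0 -> U `&` A !=set0)].
Proof.
have LP w : calL A w <-> (forall U, special_open U -> U w -> A `&` U !=set0).
  by split; [exact: calL_special|exact: special_calL].
split; first exact: LP.
  apply/seteqP; split=> [w /LP Lw U [sU UA] Uw|w Iw].
    by have [x] := Lw U sU Uw; rewrite setIC UA.
  apply/LP => U sU Uw; apply: contrapT => AU; apply: (Iw U) => //; split=> //.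
  by rewrite setIC; apply/eqP; apply: contrapT => /negP/set0P.
rewrite (rank_determiningP A0); split=> [LA U sU [w Uw]|H w].
  by rewrite setIC; exact: (LP w).1 (LA w) U sU Uw.
by apply/LP => U sU Uw; rewrite setIC; apply: H => //; exists w.
Qed.
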